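(* Let $\delta>0$. Algorithm 2 described in the context, run with tolerance $\delta$, converges to a $\delta$-optimal solution in a finite number of iterations; that is, after finitely many iterations its stopping criterion $\overline{\theta}^k-\underline{\theta}^k\le\delta$ is satisfied.
   Context: Setting. Let $\mathbf d\ge 2$ be an integer, $\mathcal M$ a finite set of states, $\Omega$ a finite set of scenarios with $\pi^\omega=1/|\Omega|$. Let $\pi^m_1\ge0$ with $\sum_m\pi^m_1=1$ and, for $d\ge2$, $\pi^{lm}_d\ge0$ with $\sum_m\pi^{lm}_d=1$ for each $l$. For $d=1,\dots,\mathbf d$: cost vector $c_d$, matrices $A_d,C_d$, a bilinear map $(x,b)\mapsto x^\top B_db$ into the right-hand-side space, and a set $\mathcal Y_d$, given by linear constraints (possibly linking scenarios), of decisions $y_d=(y^\omega_d)_{\omega\in\Omega}$; $\mathcal Y^\omega_d$ is the convex compact set of admissible components $y^\omega_d$. Data vectors $b^{m\omega}_1$, $b^{lm\omega}_d$ ($d\ge2$); write $b^{lm}_d=(b^{lm\omega}_d)_{\omega\in\Omega}$. Define $\mathcal V^m_{\mathbf d}(x,y_{\mathbf d-1},b^{lm}_{\mathbf d})=\min_{y_{\mathbf d}\in\mathcal Y_{\mathbf d}}\sum_\omega\pi^\omega c_{\mathbf d}^\top y^\omega_{\mathbf d}$ s.t. $A_{\mathbf d}y^\omega_{\mathbf d}\le x^\top B_{\mathbf d}b^{lm\omega}_{\mathbf d}+C_{\mathbf d}y_{\mathbf d-1}$ for all $\omega$; for $2\le d\le\mathbf d-1$: $\mathcal V^m_d(x,y_{d-1},b^{lm}_d)=\min_{y_d\in\mathcal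 Y_d}\sum_\omega\pi^\omega\big(c_d^\top y^\omega_d+\sum_n\pi^{mn}_{d+1}\mathcal V^n_{d+1}(x,y^\omega_d,b^{mn}_{d+1})\big)$ s.t. $A_dy^\omega_d\le x^\top B_db^{lm\omega}_d+C_dy_{d-1}$ for all $\omega$; $\mathcal V^m_1(x)=\min_{y_1\in\mathcal Y_1}\sum_\omega\pi^\omega\big(c_1^\top y^\omega_1+\sum_n\pi^{mn}_2\mathcal V^n_2(x,y^\omega_1,b^{mn}_2)\big)$ s.t. $A_1y^\omega_1\le x^\top B_1b^{m\omega}_1$; $g(x)=\sum_m\pi^m_1\mathcal V^m_1(x)$. Standing assumptions: relatively complete recourse (all problems feasible with finite value); constants $\mathrm M_y,\mathrm M_b>0$ bounding the 1-norm $\|\cdot\|$ of every subgradient of every $\mathcal V^m_d$ with respect to its $y$-argument, respectively its $b$-argument. Approximating problems (for fixed $x$). For $1\le d\le\mathbf d-1$ and $m\in\mathcal M$ (for $d=1$ the arguments $y_0,b$ are absent and the constraint is $A_1y^\omega_1\le x^\top B_1b^{m\omega}_1$), $\mathbf{LP}^m_d(x,y_{d-1},b^{lm}_d)$ carries, for each $n$, a finite collection of tuples $(\underline\theta_s,\underline\lambda_s,\underline\sigma_s,\underline\nu_s,x_s,y_s,b_s)$ and is: minimise $\sum_\omega\pi^\omega(c_d^\top y^\omega_d+\sum_n\pi^{mn}_{d+1}\underline\vartheta^{\omega n})$ over $y_d\in\mathcal Y_d$, $\underline\vartheta^{\omega n}$, s.t. $A_dy^\omega_d\le x^\top B_db^{lm\omega}_d+C_dy_{d-1}$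 and $\underline\vartheta^{\omega n}\ge\underline\theta_s+\underline\lambda_s^\top(x-x_s)+\underline\sigma_s^\top(y^\omega_d-y_s)+\underline\nu_s^\top(b^{mn}_{d+1}-b_s)$ for all $\omega,n,s$. $\mathbf{UP}^m_d(y_{d-1},b^{lm}_d)$ carries, for each $n$, a finite collection of $(\overline\theta_s,y_s,b_s)$ and is: minimise $\sum_\omega\pi^\omega(c_d^\top y^\omega_d+\sum_n\pi^{mn}_{d+1}\overline\vartheta^{\omega n})$ over $y_d\in\mathcal Y_d$, $\overline\vartheta^{\omega n},\gamma^{\omega n},\zeta^{\omega n}$, $\mu^{\omega n}_s\ge0$, s.t. the same constraints $A_dy^\omega_d\le\dots$, $\overline\vartheta^{\omega n}\ge\sum_s\mu^{\omega n}_s\overline\theta_s+\mathrm M_y\|\gamma^{\omega n}\|+\mathrm M_b\|\zeta^{\omega n}\|$, $\sum_s\mu^{\omega n}_sy_s=y^\omega_d+\gamma^{\omega n}$, $\sum_s\mu^{\omega n}_sb_s=b^{mn}_{d+1}+\zeta^{\omega n}$, $\sum_s\mu^{\omega n}_s=1$. Adding a third argument $\tilde y$ to $\mathbf{UP}$ means imposing $y_d=\tilde y$. For $d=\mathbf d$ both are the problem defining $\mathcal V^m_{\mathbf d}$. Algorithm 2 (tolerance $\delta$), from given finite cut collections: $k:=0$, $\underline\theta^m_1:=-\infty$, $\overline\theta^m_1:=+\infty$. Each iteration: $k:=k+1$. Forward pass: $m_1\in\arg\max\{\overline\theta^m_1-\underline\theta^m_1:\pi^m_1>0\}$; solve $\mathbf{LP}^{m_1}_1(x)$,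 obtaining optimal $\underline y_1$ and $\underline\vartheta^{\omega n}_2$; solve $\mathbf{UP}^{m_1}_1(\underline y_1)$ obtaining $\overline{\underline\vartheta}^{\omega n}_2$. Set $d:=1$, $\hat d:=\mathbf d$; repeat: $d:=d+1$; $(\omega_{d-1},m_d)\in\arg\max\{\overline{\underline\vartheta}^{\omega n}_d-\underline\vartheta^{\omega n}_d:\pi^{m_{d-1}n}_d>0\}$; if the maximum exceeds $\delta(\mathbf d-d+1)/(\mathbf d-1)$, solve $\mathbf{LP}^{m_d}_d(x,\underline y^{\omega_{d-1}}_{d-1},b^{m_{d-1}m_d}_d)$ getting optimal $\underline y_d$ and $\underline\vartheta^{\omega n}_{d+1}$, and $\mathbf{UP}^{m_d}_d(\underline y^{\omega_{d-1}}_{d-1},b^{m_{d-1}m_d}_d,\underline y_d)$ getting $\overline{\underline\vartheta}^{\omega n}_{d+1}$; else $\hat d:=d-1$; until $\hat d=d-1$ or $d=\mathbf d$. Backward pass: for $d=\hat d,\dots,2$ and each $m\in\mathcal M$: solve $\mathbf{LP}^m_d(x,\underline y^{\omega_{d-1}}_{d-1},b^{m_{d-1}m}_d)$, obtaining its optimal value $\underline\theta$ and subgradients $\underline\lambda,\underline\sigma,\underline\nu$ of its optimal value w.r.t. $x$, $y_{d-1}$, $b$; solve $\mathbf{UP}^m_d(\underline y^{\omega_{d-1}}_{d-1},b^{m_{d-1}m}_d)$, obtaining optimal value $\overline\theta$; for every $l\in\mathcal M$ add $(\underline\theta,\underline\lambda,\underline\sigma,\underline\nu,x,\underline y^{\omega_{d-1}}_{d-1},b^{m_{d-1}m}_d)$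 to the collection for next state $m$ of $\mathbf{LP}^l_{d-1}$ and $(\overline\theta,\underline y^{\omega_{d-1}}_{d-1},b^{m_{d-1}m}_d)$ to that of $\mathbf{UP}^l_{d-1}$. Then for each $m$ solve $\mathbf{LP}^m_1(x)$, $\mathbf{UP}^m_1$ to get $\underline\theta^m_1$, $\underline\lambda^m_1$ (subgradient w.r.t. $x$), $\overline\theta^m_1$; set $\underline\theta^k:=\sum_m\pi^m_1\underline\theta^m_1$, $\underline\lambda^k:=\sum_m\pi^m_1\underline\lambda^m_1$, $\overline\theta^k:=\sum_m\pi^m_1\overline\theta^m_1$; stop if $\overline\theta^k-\underline\theta^k\le\delta$. *)

(* Defs.v *)
From HB Require Import structures.
From mathcomp Require Import all_boot all_order all_algebra.
From mathcomp Require Import boolp classical_sets reals ereal.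
Import Order.TTheory GRing.Theory Num.Theory.
Local Open Scope ring_scope.
Local Open Scope classical_set_scope.

(* Stages d = 1 .. dd_.  St_ = set of states M, Sc_ = set of scenarios Omega. *)
(* px = dim of x; nd d = dim of a scenario component y^w_d; qd d = dim of a   *)
(* data vector b^{lm w}_d; rd d = number of rows of A_d; kd d = number of    *)
(* linear constraints defining the set Y_d.                                 *)
Record MSP (R : realType) := {
  dd_ : nat;
  St_ : finType;
  Sc_ : finType;
  px_ : nat;
  nd_ : nat -> nat;
  qd_ : nat -> nat;
  rd_ : nat -> nat;
  kd_ : nat -> nat;
  pi1_ : St_ -> R;
  pit_ : nat -> St_ -> St_ -> R;            (* pi^{lm}_d (d >= 2) *)
  cost_ : forall d, 'cV[R]_(nd_ d);
  Amat_ : forall d, 'M[R]_(rd_ d, nd_ d);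
  Cmat_ : forall d, 'M[R]_(rd_ d, nd_ d.-1);
  (* the bilinear map (x,b) |-> x^T B_d b : its i-th row is x^T (Bmat_ d i) b *)
  Bmat_ : forall d, 'I_(rd_ d) -> 'M[R]_(px_, qd_ d);
  (* Y_d = { y = (y^w)_w | \sum_w G_d^w y^w <= h_d }  (may link scenarios) *)
  Gmat_ : forall d, Sc_ -> 'M[R]_(kd_ d, nd_ d);
  hvec_ : forall d, 'cV[R]_(kd_ d);
  b1_ : St_ -> Sc_ -> 'cV[R]_(qd_ 1);
  bd_ : forall d, St_ -> St_ -> Sc_ -> 'cV[R]_(qd_ d); (* b^{lm w}_d, d>=2 *)
  My_ : R;
  Mb_ : R }.



Definition dotv {R : pzRingType} {k : nat} (u v : 'cV[R]_k) : R :=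
  \sum_(i < k) u i 0 * v i 0.
Definition norm1 {R : numDomainType} {k : nat} (v : 'cV[R]_k) : R :=
  \sum_(i < k) `|v i 0|.
Definition lemx {R : numDomainType} {m k : nat} (A B : 'M[R]_(m, k)) : Prop :=
  forall i j, A i j <= B i j.

Section MSPDefs.
Variables (R : realType) (P : MSP R).
Local Notation dd := (@dd_ R P).
Local Notation St := (@St_ R P).
Local Notation Sc := (@Sc_ R P).
Local Notation px := (@px_ R P).
Local Notation nd := (@nd_ R P).
Local Notation qd := (@qd_ R P).
Local Notation pi1 := (@pi1_ R P).
Local Notation pit := (@pit_ R P).
Local Notation cost := (@cost_ R P).
Local Notation Amat := (@Amat_ R P).
Local Notation Cmat := (@Cmat_ R P).
Local Notation b1 := (@b1_ R P).
Local Notation bd := (@bd_ R P).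
Local Notation My := (@My_ R P).
Local Notation Mb := (@Mb_ R P).

Definition piw : R := (#|Sc|%:R)^-1.

Definition dotb {d : nat} (u v : Sc -> 'cV[R]_(qd d)) : R :=
  \sum_(w : Sc) dotv (u w) (v w).
Definition normb {d : nat} (v : Sc -> 'cV[R]_(qd d)) : R :=
  \sum_(w : Sc) norm1 (v w).
Definition subb {d : nat} (u v : Sc -> 'cV[R]_(qd d)) : Sc -> 'cV[R]_(qd d) :=
  fun w => u w - v w.

Definition bil (d : nat) (x : 'cV[R]_px) (b : 'cV[R]_(qd d)) : 'cV[R]_(@rd_ R P d) :=
  \col_i (x^T *m @Bmat_ R P d i *m b) 0 0.

Definition inY (d : nat) (y : Sc -> 'cV[R]_(nd d)) : Prop :=
  lemx (\sum_(w : Sc) @Gmat_ R P d w *m y w) (@hvec_ R P d).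

Definition Ycomp (d : nat) (w : Sc) (v : 'cV[R]_(nd d)) : Prop :=
  exists y, inY d y /\ y w = v.

(* constraints of the stage-d problem:  y_d \in Y_d  and
   A_d y^w_d <= x^T B_d b^w + C_d y_{d-1}  for all w.
   (For d = 1 it is used with y_0 = 0, so that the C-term vanishes.) *)
Definition stagecon (d : nat) (x : 'cV[R]_px) (yprev : 'cV[R]_(nd d.-1))
    (b : Sc -> 'cV[R]_(qd d)) (y : Sc -> 'cV[R]_(nd d)) : Prop :=
  inY d y /\
  forall w, lemx (Amat d *m y w) (bil d x (b w) + Cmat d *m yprev).

(* The value functions V^m_d, defined by backward recursion; the fuel j is
   the number of remaining stages (j = dd - d), j = 0 is the last stage. *)
Fixpoint Vfun (j : nat) (d : nat) (m : St) (x : 'cV[R]_px)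
    (yprev : 'cV[R]_(nd d.-1)) (b : Sc -> 'cV[R]_(qd d)) {struct j} : \bar R :=
  ereal_inf [set (\sum_(w : Sc)
      ((piw)%:E * ((dotv (cost d) (y w))%:E +
        match j with
        | 0 => 0%E
        | j'.+1 => \sum_(n : St)
                     ((pit d.+1 m n)%:E * Vfun j' d.+1 n x (y w) (bd d.+1 m n))%E
        end)%E)%E)
     | y in [set y | stagecon d x yprev b y]].

Definition V (d : nat) (m : St) (x : 'cV[R]_px) (yprev : 'cV[R]_(nd d.-1))
    (b : Sc -> 'cV[R]_(qd d)) : \bar R :=
  Vfun (dd - d) d m x yprev b.
Definition V1 (m : St) (x : 'cV[R]_px) : \bar R :=
  Vfun (dd - 1) 1 m x 0 (b1 m).

(* Cuts.  A lower cut stored in a collection of a stage-d problem LP^l_d      *)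
(* (for some next state n):  (theta, lambda, sigma, nu, x_s, y_s, b_s).       *)
Record lcut (d : nat) := LCut {
  lc_th : R;
  lc_lam : 'cV[R]_px;
  lc_sig : 'cV[R]_(nd d);
  lc_nu : Sc -> 'cV[R]_(qd d.+1);
  lc_x : 'cV[R]_px;
  lc_y : 'cV[R]_(nd d);
  lc_b : Sc -> 'cV[R]_(qd d.+1) }.
Record ucut (d : nat) := UCut {
  uc_th : R;
  uc_y : 'cV[R]_(nd d);
  uc_b : Sc -> 'cV[R]_(qd d.+1) }.

Arguments lc_th {d}. Arguments lc_lam {d}. Arguments lc_sig {d}. Arguments lc_nu {d}.
Arguments lc_x {d}. Arguments lc_y {d}. Arguments lc_b {d}.
Arguments uc_th {d}. Arguments uc_y {d}. Arguments uc_b {d}.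

Definition lcut0 (d : nat) : lcut d := LCut d 0 0 0 (fun _ => 0) 0 0 (fun _ => 0).
Definition ucut0 (d : nat) : ucut d := UCut d 0 0 (fun _ => 0).

(* collections: (stage d, current state l, next state n) |-> finite list *)
Definition lcolls := forall d : nat, St -> St -> seq (lcut d).
Definition ucolls := forall d : nat, St -> St -> seq (ucut d).

Definition cutval {d : nat} (s : lcut d) (x : 'cV[R]_px) (y : 'cV[R]_(nd d))
    (b : Sc -> 'cV[R]_(qd d.+1)) : R :=
  lc_th s + dotv (lc_lam s) (x - lc_x s) + dotv (lc_sig s) (y - lc_y s)
  + dotb (lc_nu s) (subb b (lc_b s)).

Definition notlast (d : nat) : bool := (d < dd)%N.

Definition stobj (d : nat) (m : St) (y : Sc -> 'cV[R]_(nd d)) (th : Sc -> St -> R) : R :=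
  \sum_(w : Sc) piw * (dotv (cost d) (y w) +
     (if notlast d then \sum_(n : St) pit d.+1 m n * th w n else 0)).

(* LP^m_d(x, y_{d-1}, b) with cut collection S (indexed by the next state);
   at d = dd it is the problem defining V^m_dd (the variables th are void). *)
Definition LPfeas (d : nat) (m : St) (S : St -> seq (lcut d)) (x : 'cV[R]_px)
    (yprev : 'cV[R]_(nd d.-1)) (b : Sc -> 'cV[R]_(qd d))
    (y : Sc -> 'cV[R]_(nd d)) (th : Sc -> St -> R) : Prop :=
  stagecon d x yprev b y /\
  (notlast d -> forall w n i, (i < size (S n))%N ->
     cutval (nth (lcut0 d) (S n) i) x (y w) (bd d.+1 m n) <= th w n).

Definition LPopt d m S x yprev b y th : Prop :=
  LPfeas d m S x yprev b y th /\
  forall y' th', LPfeas d m S x yprev b y' th' -> stobj d m y th <= stobj d m y' th'.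

Definition LPval (d : nat) (m : St) (S : St -> seq (lcut d)) (x : 'cV[R]_px)
    (yprev : 'cV[R]_(nd d.-1)) (b : Sc -> 'cV[R]_(qd d)) : \bar R :=
  ereal_inf [set (stobj d m z.1 z.2)%:E
            | z in [set z | LPfeas d m S x yprev b z.1 z.2]].

(* UP^m_d(y_{d-1}, b): variables y, overline vartheta (thb), gamma (gam),
   zeta (zet) and mu (mu w n i = mu^{wn}_s for the i-th element s of S n). *)
Definition UPfeas (d : nat) (m : St) (S : St -> seq (ucut d)) (x : 'cV[R]_px)
    (yprev : 'cV[R]_(nd d.-1)) (b : Sc -> 'cV[R]_(qd d))
    (y : Sc -> 'cV[R]_(nd d)) (thb : Sc -> St -> R)
    (gam : Sc -> St -> 'cV[R]_(nd d)) (zet : Sc -> St -> Sc -> 'cV[R]_(qd d.+1))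
    (mu : Sc -> St -> nat -> R) : Prop :=
  stagecon d x yprev b y /\
  (notlast d -> forall w n,
     (forall i, (i < size (S n))%N -> 0 <= mu w n i) /\
     \sum_(i < size (S n)) mu w n i * uc_th (nth (ucut0 d) (S n) i)
        + My * norm1 (gam w n) + Mb * normb (zet w n) <= thb w n /\
     \sum_(i < size (S n)) mu w n i *: uc_y (nth (ucut0 d) (S n) i) = y w + gam w n /\
     (forall w', \sum_(i < size (S n)) mu w n i *: uc_b (nth (ucut0 d) (S n) i) w'
                 = bd d.+1 m n w' + zet w n w') /\
     \sum_(i < size (S n)) mu w n i = 1).

Definition UPopt d m S x yprev b y thb gam zet mu : Prop :=
  UPfeas d m S x yprev b y thb gam zet mu /\
  forall y' thb' gam' zet' mu', UPfeas d m S x yprev b y' thb' gam' zet' mu' ->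
    stobj d m y thb <= stobj d m y' thb'.

Definition UPoptFix d m S x yprev b ytil thb gam zet mu : Prop :=
  UPfeas d m S x yprev b ytil thb gam zet mu /\
  forall thb' gam' zet' mu', UPfeas d m S x yprev b ytil thb' gam' zet' mu' ->
    stobj d m ytil thb <= stobj d m ytil thb'.

Definition UPval (d : nat) (m : St) (S : St -> seq (ucut d)) (x : 'cV[R]_px)
    (yprev : 'cV[R]_(nd d.-1)) (b : Sc -> 'cV[R]_(qd d)) : \bar R :=
  ereal_inf [set (stobj d m z.1.1.1.1 z.1.1.1.2)%:E
            | z in [set z | UPfeas d m S x yprev b z.1.1.1.1 z.1.1.1.2
                                   z.1.1.2 z.1.2 z.2]].

Definition standing (x : 'cV[R]_px) : Prop :=
  (2 <= dd)%N /\
  (0 < #|Sc|)%N /\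
  (forall m, 0 <= pi1 m) /\ \sum_(m : St) pi1 m = 1 /\
  (forall d, (2 <= d <= dd)%N -> forall l m, 0 <= pit d l m) /\
  (forall d, (2 <= d <= dd)%N -> forall l, \sum_(m : St) pit d l m = 1) /\
  (* the sets Y^w_d are compact (the polyhedra Y_d are bounded) *)
  (forall d, (1 <= d <= dd)%N ->
     exists K : R, forall y, inY d y -> forall w, norm1 (y w) <= K) /\
  (* relatively complete recourse: all problems feasible with finite value *)
  (forall m, V1 m x \is a fin_num) /\
  (forall d, (2 <= d <= dd)%N -> forall l m w (v : 'cV[R]_(nd d.-1)),
     Ycomp d.-1 w v -> V d m x v (bd d l m) \is a fin_num) /\
  0 < My /\ 0 < Mb /\
  (forall d, (2 <= d <= dd)%N -> forall l m w (v : 'cV[R]_(nd d.-1)),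
     Ycomp d.-1 w v ->
     (forall g : 'cV[R]_(nd d.-1),
        (forall v', (V d m x v (bd d l m) + (dotv g (v' - v))%:E
                     <= V d m x v' (bd d l m))%E) ->
        norm1 g <= My) /\
     (forall g : Sc -> 'cV[R]_(qd d),
        (forall b', (V d m x v (bd d l m) + (dotb g (subb b' (bd d l m)))%:E
                     <= V d m x v b')%E) ->
        normb g <= Mb)).

(* Data produced by one iteration:                                          *)
(*  it_m d = m_d, it_w d = omega_d, it_y d = underline y_d,                  *)
(*  it_lv d w n = underline vartheta^{wn}_d,                                 *)
(*  it_uv d w n = overline-underline vartheta^{wn}_d, it_dhat = hat d,       *)
(*  it_lc d n / it_uc d n = the lower / upper cut obtained in the backward     *)
(*  pass by solving LP^n_{d+1} / UP^n_{d+1} (and added to stage d).          *)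
Record itdata := ItData {
  it_m : nat -> St;
  it_w : nat -> Sc;
  it_y : forall d, Sc -> 'cV[R]_(nd d);
  it_lv : nat -> Sc -> St -> R;
  it_uv : nat -> Sc -> St -> R;
  it_dhat : nat;
  it_lc : forall d, St -> lcut d;
  it_uc : forall d, St -> ucut d }.

(* the backward pass adds, for every l, the cut obtained from LP^n_{d+1}
   (d+1 = hat d, ..., 2) to the collection for next state n of LP^l_d *)
Definition updL (L : lcolls) (it : itdata) : lcolls :=
  fun d l n => L d l n ++ (if (1 <= d < it_dhat it)%N then [:: it_lc it d n] else [::]).
Definition updU (U : ucolls) (it : itdata) : ucolls :=
  fun d l n => U d l n ++ (if (1 <= d < it_dhat it)%N then [:: it_uc it d n] else [::]).

Variables (x : 'cV[R]_px) (delta : R).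

Definition thr (d : nat) : R := delta * (dd - d + 1)%:R / (dd - 1)%:R.

Definition th1 (L : lcolls) (m : St) : \bar R := LPval 1 m (L 1%N m) x 0 (b1 m).
Definition uth1 (U : ucolls) (m : St) : \bar R := UPval 1 m (U 1%N m) x 0 (b1 m).
Definition lowb (L : lcolls) : \bar R := (\sum_(m : St) (pi1 m)%:E * th1 L m)%E.
Definition uppb (U : ucolls) : \bar R := (\sum_(m : St) (pi1 m)%:E * uth1 U m)%E.

(* One iteration, starting from collections L, U and from the previous gaps
   pg m = overline theta^m_1 - underline theta^m_1. *)
Definition IterOK (L : lcolls) (U : ucolls) (pg : St -> \bar R) (it : itdata) : Prop :=
  let L' := updL L it in
  let U' := updU U it in
  let mm := it_m it in let ww := it_w it in let yy := it_y it in
  let lv := it_lv it in let uv := it_uv it in let dh := it_dhat it in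
  (0 < pi1 (mm 1%N) /\ forall m, 0 < pi1 m -> (pg m <= pg (mm 1%N))%E) /\
  LPopt 1 (mm 1%N) (L 1%N (mm 1%N)) x 0 (b1 (mm 1%N)) (yy 1%N) (lv 2%N) /\
  (exists gam zet mu,
     UPoptFix 1 (mm 1%N) (U 1%N (mm 1%N)) x 0 (b1 (mm 1%N)) (yy 1%N) (uv 2%N) gam zet mu) /\
  (1 <= dh <= dd)%N /\
  (forall d, (2 <= d <= dh)%N ->
     0 < pit d (mm d.-1) (mm d) /\
     (forall w n, 0 < pit d (mm d.-1) n ->
        uv d w n - lv d w n <= uv d (ww d.-1) (mm d) - lv d (ww d.-1) (mm d)) /\
     thr d < uv d (ww d.-1) (mm d) - lv d (ww d.-1) (mm d) /\
     LPopt d (mm d) (L d (mm d)) x (yy d.-1 (ww d.-1)) (bd d (mm d.-1) (mm d))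
           (yy d) (lv d.+1) /\
     ((d < dd)%N -> exists gam zet mu,
        UPoptFix d (mm d) (U d (mm d)) x (yy d.-1 (ww d.-1)) (bd d (mm d.-1) (mm d))
                 (yy d) (uv d.+1) gam zet mu)) /\
  (* the forward pass stopped at hat d < dd because the maximal gap at stage
     hat d + 1 did not exceed the threshold *)
  ((dh < dd)%N -> forall w n, 0 < pit dh.+1 (mm dh) n ->
     uv dh.+1 w n - lv dh.+1 w n <= thr dh.+1) /\
  (forall d, (1 <= d < dh)%N -> forall n,
     let yp := yy d (ww d) in
     let bv := bd d.+1 (mm d) n in
     let c := it_lc it d n in
     let u := it_uc it d n in
     lc_x c = x /\ lc_y c = yp /\ lc_b c = bv /\
     (exists y' th', LPopt d.+1 n (L' d.+1 n) x yp bv y' th') /\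
     (lc_th c)%:E = LPval d.+1 n (L' d.+1 n) x yp bv /\
     (forall x', ((lc_th c + dotv (lc_lam c) (x' - x))%:E
                  <= LPval d.+1 n (L' d.+1 n) x' yp bv)%E) /\
     (forall y', ((lc_th c + dotv (lc_sig c) (y' - yp))%:E
                  <= LPval d.+1 n (L' d.+1 n) x y' bv)%E) /\
     (forall b', ((lc_th c + dotb (lc_nu c) (subb b' bv))%:E
                  <= LPval d.+1 n (L' d.+1 n) x yp b')%E) /\
     uc_y u = yp /\ uc_b u = bv /\
     (exists y' thb gam zet mu, UPopt d.+1 n (U' d.+1 n) x yp bv y' thb gam zet mu) /\
     (uc_th u)%:E = UPval d.+1 n (U' d.+1 n) x yp bv) /\
  (forall m, (exists y' th', LPopt 1 m (L' 1%N m) x 0 (b1 m) y' th') /\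
             (exists y' thb gam zet mu, UPopt 1 m (U' 1%N m) x 0 (b1 m) y' thb gam zet mu)).

Variables (L0 : lcolls) (U0 : ucolls) (its : nat -> itdata).

(* collections after k iterations (its k is the data of iteration k+1) *)
Fixpoint Lk (k : nat) : lcolls :=
  match k with 0 => L0 | k'.+1 => updL (Lk k') (its k') end.
Fixpoint Uk (k : nat) : ucolls :=
  match k with 0 => U0 | k'.+1 => updU (Uk k') (its k') end.

(* previous gaps overline theta^m_1 - underline theta^m_1 before iteration k+1;
   initially overline theta^m_1 = +oo and underline theta^m_1 = -oo *)
Definition prevgap (k : nat) : St -> \bar R :=
  match k with
  | 0 => fun _ => (+oo - -oo)%E
  | k'.+1 => fun m => (uth1 (Uk k) m - th1 (Lk k) m)%E
  end.

(* the stopping criterion overline theta - underline theta <= delta holds at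
   the end of iteration k+1 *)
Definition stopped (k : nat) : Prop := (uppb (Uk k.+1) - lowb (Lk k.+1) <= delta%:E)%E.

(* its is a run of Algorithm 2: every iteration that is performed (i.e. every
   iteration not preceded by a stop) follows the algorithm *)
Definition run2 : Prop :=
  forall k, (forall j, (j < k)%N -> ~ stopped j) ->
    IterOK (Lk k) (Uk k) (prevgap k) (its k).

End MSPDefs.

(* Main.v *)
Require Import Defs.
From mathcomp Require Import all_boot all_order all_algebra.
From mathcomp Require Import boolp classical_sets reals ereal.
From mathcomp Require Import ring lra.
Import Order.TTheory GRing.Theory Num.Theory.
Local Open Scope ring_scope.

(** The gap between the upper and the lower problem splits over the stages. If
the algorithm never stops, every iteration but the first goes forward to a stage
[D >= 2] at which the gap exceeds [thr D], while the pair of cuts it then adds at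
stage [D - 1] has a gap of at most [thr D - delta / (dd - 1)], since the gap at the
next stage is below the next threshold (or there is no next stage). By the pigeonhole
principle two iterations share [D], the states, the scenario and, up to a small error,
the point [y] at which the cut is placed; the cuts of the first iteration then force
the gap of the second one below [thr D], a contradiction.

This needs the slopes of the lower cuts to be bounded uniformly. They are
subgradients of the approximating problems, for which nothing is assumed. However,
these problems have the same domain as the value functions. The latter are
polyhedral (Fourier-Motzkin elimination), hence subdifferentiable, and as all
their subgradients are bounded, the relevant points lie in the interior of the domain,
uniformly by compactness. On the domain the approximating problems are bounded
uniformly in the iteration, by backward induction on the stage, and this bounds their
subgradients at interior points. *)

(** * Fourier-Motzkin elimination *)

Section Polyhedra.
Variable R : realFieldType.

Section FourierMotzkin.
Variables (I : finType) (a : I -> R).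

(* Multipliers of the constraints [p.1] and [p.2] in the combination that
   eliminates the variable with coefficients [a]; they are both zero if the pair
   is of no use. *)
Definition fm_l (p : I * I) : R :=
  if a p.1 == 0 then 1 else if (0 < a p.1) && (a p.2 < 0) then - a p.2 else 0.
Definition fm_r (p : I * I) : R :=
  if a p.1 == 0 then 0 else if (0 < a p.1) && (a p.2 < 0) then a p.1 else 0.

Lemma fm_l_ge0 p : 0 <= fm_l p.
Proof.
by rewrite /fm_l; case: ifP => // _; case: ifP => // /andP[_ h]; rewrite oppr_ge0 ltW.
Qed.

Lemma fm_r_ge0 p : 0 <= fm_r p.
Proof.
by rewrite /fm_r; case: ifP => // _; case: ifP => // /andP[h _]; rewrite ltW.
Qed.

Lemma fm_cancel p : fm_l p * a p.1 + fm_r p * a p.2 = 0.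
Proof.
rewrite /fm_l /fm_r; case: ifP => [/eqP ->|_]; first by rewrite mulr0 mul0r addr0.
by case: ifP => _; ring.
Qed.

(** The hypothesis puts every lower bound on [s], coming from a negative coefficient, below every
    upper bound, coming from a positive one. So the largest lower bound solves the system, or the
    smallest upper bound if there is no lower one. *)
Lemma fm_solvable (g : I -> R) :
  (forall p, fm_l p * g p.1 + fm_r p * g p.2 <= 0) ->
  exists s, forall i, g i + a i * s <= 0.
Proof.
move=> H.
have H0 i : a i = 0 -> g i <= 0.
  move=> ai; have := H (i, i); rewrite /fm_l /fm_r /= ai eqxx; lra.
have Hpn i k : 0 < a i -> a k < 0 -> - a k * g i + a i * g k <= 0.
  by move=> ai ak; have := H (i, k); rewrite /fm_l /fm_r /= ai ak /= gt_eqF.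
have up i s : 0 < a i -> s <= - g i / a i -> g i + a i * s <= 0.
  by move=> ai; rewrite ler_pdivlMr // => h; lra.
have lo i s : a i < 0 -> - g i / a i <= s -> g i + a i * s <= 0.
  by move=> ai; rewrite ler_ndivrMr // => h; lra.
have mid i k : 0 < a i -> a k < 0 -> - g k / a k <= - g i / a i.
  move=> ai ak; rewrite ler_pdivlMr // mulrAC ler_ndivrMr //.
  by have := Hpn _ _ ai ak; lra.
case: (pickP (fun k => a k < 0)) => [k0 ak0|noneg].
  case: (@Order.TotalTheory.arg_maxP _ _ _ k0 (fun k => a k < 0)
    (fun k => - g k / a k) ak0) => k ak kmax.
  exists (- g k / a k) => i; case: (ltrgtP (a i) 0) => ai.
  - by apply: lo => //; apply: kmax.
  - by apply: up => //; apply: mid.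
  - by rewrite ai mul0r addr0 H0.
case: (pickP (fun k => 0 < a k)) => [k0 ak0|nopos].
  case: (@Order.TotalTheory.arg_minP _ _ _ k0 (fun k => 0 < a k)
    (fun k => - g k / a k) ak0) => k ak kmin.
  exists (- g k / a k) => i; case: (ltrgtP (a i) 0) => ai.
  - by have := noneg i; rewrite ai.
  - by apply: up => //; apply: kmin.
  - by rewrite ai mul0r addr0 H0.
exists 0 => i; rewrite mulr0 addr0; apply: H0.
by case: (ltrgtP (a i) 0) => // ai; [have := noneg i | have := nopos i]; rewrite ai.
Qed.

End FourierMotzkin.

(* [Phi] plays the role of the space of affine functions on [T], so that no
   vector space structure on [T] is needed. *)
Definition affspace (T : Type) (Phi : (T -> R) -> Prop) : Prop :=
  [/\ forall c, Phi (fun _ => c),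
      forall f g, Phi f -> Phi g -> Phi (fun z => f z + g z) &
      forall c f, Phi f -> Phi (fun z => c * f z)].

Definition polyhedral (T : Type) (Phi : (T -> R) -> Prop) (S : T -> Prop) : Prop :=
  exists (I : finType) (f : I -> T -> R),
    (forall i, Phi (f i)) /\ forall z, S z <-> forall i, f i z <= 0.

(** The affine functions on the product of [T] with the space of real vectors indexed by [J]. *)
Definition affext (T : Type) (Phi : (T -> R) -> Prop) (J : finType)
    (f : T * (J -> R) -> R) : Prop :=
  exists g a, Phi g /\ f = fun zy => g zy.1 + \sum_j a j * zy.2 j.
Arguments affext {T} Phi J f.

(** * Closure properties of polyhedral sets, including projection *)

Section Closure.
Variables (T : Type) (Phi : (T -> R) -> Prop).
Hypothesis aPhi : affspace T Phi.

Lemma aff_cst c : Phi (fun _ => c). Proof. by case: aPhi. Qed.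
Lemma aff_add f g : Phi f -> Phi g -> Phi (fun z => f z + g z).
Proof. by case: aPhi => _ h _; apply: h. Qed.
Lemma aff_scale c f : Phi f -> Phi (fun z => c * f z).
Proof. by case: aPhi => _ _; apply. Qed.

Lemma aff_sum (K : Type) (s : seq K) (F : K -> T -> R) :
  (forall k, Phi (F k)) -> Phi (fun z => \sum_(k <- s) F k z).
Proof.
move=> PF; elim: s => [|k s IH].
  have -> : (fun z => \sum_(k <- [::]) F k z) = (fun=> 0).
    by apply: funext => z; rewrite big_nil.
  exact: aff_cst.
have -> : (fun z => \sum_(k <- k :: s) F k z) = (fun z => F k z + \sum_(k <- s) F k z).
  by apply: funext => z; rewrite big_cons.
exact: aff_add.
Qed.

Lemma aff_sub f g : Phi f -> Phi g -> Phi (fun z => f z - g z).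
Proof.
move=> Pf Pg; have -> : (fun z => f z - g z) = (fun z => f z + (-1) * g z).
  by apply: funext => z; rewrite mulN1r.
by apply: aff_add => //; apply: aff_scale.
Qed.

Lemma polyhedral_le f g : Phi f -> Phi g -> polyhedral T Phi (fun z => f z <= g z).
Proof.
move=> Pf Pg; exists unit, (fun _ z => f z - g z); split=> [_|z]; first exact: aff_sub.
by split=> [h _|/(_ tt)]; rewrite subr_le0.
Qed.

Lemma polyhedral_ext S S' : (forall z, S z <-> S' z) ->
  polyhedral T Phi S -> polyhedral T Phi S'.
Proof.
move=> SS' [I [f [Pf fE]]]; exists I, f; split=> // z.
by rewrite -fE; split=> /SS'.
Qed.

Lemma polyhedral_and S S' : polyhedral T Phi S -> polyhedral T Phi S' ->
  polyhedral T Phi (fun z => S z /\ S' z).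
Proof.
move=> [I [f [Pf fE]]] [I' [f' [Pf' fE']]].
exists (I + I')%type, (fun k => match k with inl i => f i | inr i => f' i end).
split=> [[]//|z]; split=> [[/fE h /fE' h'] []//|h].
by split; [apply/fE => i; apply: (h (inl i))|apply/fE' => i; apply: (h (inr i))].
Qed.

Lemma polyhedral_forall (K : finType) (S : K -> T -> Prop) :
  (forall k, polyhedral T Phi (S k)) -> polyhedral T Phi (fun z => forall k, S k z).
Proof.
move=> PS; have [I PI] := choice PS.
pose f k := projT1 (cid (PI k)); have Pf k : (forall i, Phi (f k i)) /\
    forall z, S k z <-> forall i, f k i z <= 0 := projT2 (cid (PI k)).
exists {k : K & I k}, (fun u => f (tag u) (tagged u)).
split=> [u|z]; first by case: (Pf (tag u)) => + _; apply.
split=> [h u|h k]; first by case: (Pf (tag u)) => _ /(_ z)[h' _]; apply: h'.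
by case: (Pf k) => _ /(_ z)[_]; apply => i; apply: (h (Tagged I i)).
Qed.

Lemma affext_affspace (J : finType) : affspace _ (affext Phi J).
Proof.
split.
- move=> c; exists (fun=> c), (fun=> 0); split; first exact: aff_cst.
  by apply: funext => zy; rewrite big1 ?addr0// => j _; rewrite mul0r.
- move=> f1 f2 [g1 [a1 [P1 ->]]] [g2 [a2 [P2 ->]]].
  exists (fun z => g1 z + g2 z), (fun j => a1 j + a2 j); split; first exact: aff_add.
  apply: funext => zy; rewrite addrACA -big_split /=; congr (_ + _).
  by apply: eq_bigr => j _; rewrite mulrDl.
- move=> c f [g [a [Pg ->]]].
  exists (fun z => c * g z), (fun j => c * a j); split; first exact: aff_scale.
  apply: funext => zy; rewrite mulrDr mulr_sumr; congr (_ + _).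
  by apply: eq_bigr => j _; rewrite mulrA.
Qed.

Lemma affext_fst (J : finType) f : Phi f -> affext Phi J (fun zy => f zy.1).
Proof.
move=> Pf; exists f, (fun=> 0); split=> //.
by apply: funext => zy; rewrite big1 ?addr0// => j _; rewrite mul0r.
Qed.

Lemma affext_coord (J : finType) (j : J) : affext Phi J (fun zy => zy.2 j).
Proof.
exists (fun=> 0), (fun k => (k == j)%:R); split; first exact: aff_cst.
apply: funext => zy; rewrite add0r (bigD1 j)//= eqxx mul1r big1 ?addr0//.
by move=> k /negPf ->; rewrite mul0r.
Qed.

(** Induction on the list [s] of variables still to be eliminated: one step replaces the constraints
    by their pairwise combinations, in which the coefficients of [j] cancel, while coefficients
    outside [s] stay zero. *)
Lemma eliminate_seq (J : finType) (s : seq J) (I : finType) (g : I -> T -> R)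
    (a : I -> J -> R) :
  (forall i, Phi (g i)) -> (forall i j, j \notin s -> a i j = 0) ->
  polyhedral T Phi (fun z => exists y, forall i, g i z + \sum_j a i j * y j <= 0).
Proof.
elim: s I g a => [|j s IH] I g a Pg as0.
  exists I, g; split=> // z.
  have s0 i y : g i z + \sum_j a i j * y j = g i z.
    by rewrite big1 ?addr0// => j _; rewrite as0 ?mul0r.
  by split=> [[y h] i|h]; [rewrite -(s0 i y)|exists (fun=> 0) => i; rewrite s0].
pose l := fm_l I (a^~ j); pose r := fm_r I (a^~ j).
apply: polyhedral_ext (IH (I * I)%type (fun p z => l p * g p.1 z + r p * g p.2 z)
           (fun p k => l p * a p.1 k + r p * a p.2 k) _ _) => [z|p|p k ks]; last 2 first.
- by apply: aff_add; apply: aff_scale.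
- have [->|kj] := eqVneq k j; first exact: fm_cancel.
  by rewrite !as0 ?inE ?negb_or ?kj// !mulr0 addr0.
have comb p y : l p * g p.1 z + r p * g p.2 z +
     \sum_k (l p * a p.1 k + r p * a p.2 k) * y k =
   l p * (g p.1 z + \sum_k a p.1 k * y k) + r p * (g p.2 z + \sum_k a p.2 k * y k).
  rewrite !mulrDr !mulr_sumr addrACA -big_split/=; congr (_ + _).
  by apply: eq_bigr => k _; rewrite mulrDl !mulrA.
split=> [[y h]|[y h]].
  have [|t ht] := fm_solvable I (a^~ j)
    (fun i => g i z + \sum_(k | k != j) a i k * y k).
    have splitj i : \sum_k a i k * y k = a i j * y j + \sum_(k | k != j) a i k * y k.
      by rewrite (bigD1 j).
    move=> p; apply: le_trans (h p); rewrite comb !splitj le_eqVlt; apply/orP; left.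
    have := fm_cancel I (a^~ j) p; rewrite -/(l p) -/(r p).
    set A := \sum_(k | _) _; set B := \sum_(k | _) _ => e; apply/eqP.
    transitivity (l p * (g p.1 z + A) + r p * (g p.2 z + B)
                  + (l p * a p.1 j + r p * a p.2 j) * y j).
      by rewrite e mul0r addr0.
    ring.
  exists (fun k => if k == j then t else y k) => i.
  rewrite (bigD1 j)//= eqxx addrCA addrC; apply: le_trans (ht i).
  by rewrite lerD2r lerD2l; apply: ler_sum => k /negPf ->.
exists y => p; rewrite comb.
have := mulr_ge0_le0 (fm_l_ge0 I (a^~ j) p) (h p.1).
have := mulr_ge0_le0 (fm_r_ge0 I (a^~ j) p) (h p.2).
by rewrite -/(l p) -/(r p) => h1 h2; lra.
Qed.

Lemma polyhedral_exists (J : finType) (S : T -> (J -> R) -> Prop) :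
  polyhedral _ (affext Phi J) (fun zy => S zy.1 zy.2) ->
  polyhedral T Phi (fun z => exists y, S z y).
Proof.
move=> [I [f [Pf fE]]]; have [g Pg] := choice Pf; have [a ga] := choice Pg.
apply: polyhedral_ext (eliminate_seq J (enum J) I g a _ _) => [z|i|i j]; last 2 first.
- by case: (ga i).
- by rewrite mem_enum.
have fga i y : f i (z, y) = g i z + \sum_j a i j * y j by case: (ga i) => _ ->.
split=> -[y h]; exists y.
  by apply/(fE (z, y)) => i; rewrite fga.
by move=> i; rewrite -fga; move: i; apply/fE.
Qed.

End Closure.
End Polyhedra.

Arguments affspace {R T} Phi.
Arguments polyhedral {R T} Phi S.
Arguments affext {R T} Phi J f.
Arguments aff_cst {R T Phi}.
Arguments aff_add {R T Phi}.
Arguments aff_scale {R T Phi}.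
Arguments aff_sum {R T Phi}.
Arguments polyhedral_le {R T Phi}.
Arguments polyhedral_ext {R T Phi S S'}.
Arguments polyhedral_and {R T Phi}.
Arguments polyhedral_forall {R T Phi K S}.
Arguments affext_affspace {R T Phi}.
Arguments affext_fst {R T Phi}.
Arguments affext_coord {R T Phi}.
Arguments polyhedral_exists {R T Phi}.

(** * The 1-norm and the scalar product *)

Section Norm1.
Variables (R : realFieldType) (k : nat).
Implicit Types u v w : 'cV[R]_k.

Lemma dotvDl u v w : dotv (u + v) w = dotv u w + dotv v w.
Proof. by rewrite -big_split; apply: eq_bigr => i _; rewrite mxE mulrDl. Qed.

Lemma dotvDr u v w : dotv w (u + v) = dotv w u + dotv w v.
Proof. by rewrite -big_split; apply: eq_bigr => i _; rewrite mxE mulrDr. Qed.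

Lemma dotvZl c u v : dotv (c *: u) v = c * dotv u v.
Proof. by rewrite mulr_sumr; apply: eq_bigr => i _; rewrite mxE mulrA. Qed.

Lemma dotvZr c u v : dotv u (c *: v) = c * dotv u v.
Proof. by rewrite mulr_sumr; apply: eq_bigr => i _; rewrite mxE mulrCA. Qed.

Lemma dotvBr u v w : dotv w (u - v) = dotv w u - dotv w v.
Proof. by rewrite dotvDr -scaleN1r dotvZr mulN1r. Qed.

Lemma dotv0l v : dotv 0 v = 0.
Proof. by rewrite /dotv big1 // => i _; rewrite mxE mul0r. Qed.

Lemma dotv0r v : dotv v 0 = 0.
Proof. by rewrite /dotv big1 // => i _; rewrite mxE mulr0. Qed.

Lemma dotv_delta u i : dotv u (delta_mx i 0) = u i 0.
Proof.
rewrite /dotv (bigD1 i)//= mxE !eqxx mulr1 big1 ?addr0// => j /negPf ji.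
by rewrite mxE ji mulr0.
Qed.

Lemma norm1_ge0 v : 0 <= norm1 v.
Proof. by apply: sumr_ge0 => i _. Qed.

Lemma norm10 : norm1 (0 : 'cV[R]_k) = 0.
Proof. by rewrite /norm1 big1 // => i _; rewrite mxE normr0. Qed.

Lemma norm1N v : norm1 (- v) = norm1 v.
Proof. by apply: eq_bigr => i _; rewrite mxE normrN. Qed.

Lemma norm1Z c v : norm1 (c *: v) = `|c| * norm1 v.
Proof. by rewrite mulr_sumr; apply: eq_bigr => i _; rewrite mxE normrM. Qed.

Lemma norm1D u v : norm1 (u + v) <= norm1 u + norm1 v.
Proof. by rewrite -big_split; apply: ler_sum => i _; rewrite mxE ler_normD. Qed.

Lemma norm1B u v : norm1 (u - v) <= norm1 u + norm1 v.
Proof. by rewrite -(norm1N v) norm1D. Qed.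

Lemma norm1_coord v i : `|v i 0| <= norm1 v.
Proof. by rewrite /norm1 (bigD1 i)//= lerDl sumr_ge0. Qed.

Lemma norm1_eq0 v : norm1 v = 0 -> v = 0.
Proof.
move=> v0; apply/matrixP => i j; rewrite (ord1 j) mxE; apply/eqP.
by rewrite -normr_le0 -v0 norm1_coord.
Qed.

Lemma norm1_delta i : norm1 (delta_mx i 0 : 'cV[R]_k) = 1.
Proof.
rewrite /norm1 (bigD1 i)//= mxE !eqxx normr1 big1 ?addr0// => j /negPf ji.
by rewrite mxE ji normr0.
Qed.

Lemma norm_dotv u v : `|dotv u v| <= norm1 u * norm1 v.
Proof.
apply: le_trans (ler_norm_sum _ _ _) _.
rewrite mulr_suml; apply: ler_sum => i _; rewrite normrM.
by apply: ler_wpM2l => //; apply: norm1_coord.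
Qed.

Lemma norm1_le v c : (forall i, `|v i 0| <= c) -> norm1 v <= k%:R * c.
Proof.
move=> vc; apply: (le_trans (ler_sum _ (fun i _ => vc i))).
by rewrite sumr_const card_ord mulr_natl.
Qed.

End Norm1.

(** * Uniform constants over finite families and the pigeonhole principle *)

Section FinUniform.
Variable R : realFieldType.

Lemma fin_uniform_lb (I : finType) (Q : I -> R -> Prop) :
  (forall i r s, 0 < s <= r -> Q i r -> Q i s) ->
  (forall i, exists2 r, 0 < r & Q i r) ->
  exists2 r, 0 < r & forall i, Q i r.
Proof.
move=> Qmono Qex.
have /choice[f Qf] i : exists r, 0 < r /\ Q i r by have [r] := Qex i; exists r.
(* The default 1 keeps the minimum positive, also for an empty family. *)
exists (\big[Num.min/1]_i f i).
  by apply: lt_bigmin => // i _; case: (Qf i).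
move=> i; have [fi0 Qi] := Qf i; apply: Qmono Qi.
rewrite lt_bigmin//=; last by move=> j _; case: (Qf j).
exact: bigmin_le_cond.
Qed.

Lemma fin_uniform_ub (I : finType) (Q : I -> R -> Prop) :
  (forall i r s, r <= s -> Q i r -> Q i s) ->
  (forall i, exists r, Q i r) -> exists2 r, 0 <= r & forall i, Q i r.
Proof.
move=> Qmono /choice[f Qf].
exists (\big[Num.max/0]_i f i); first exact: bigmax_ge_id.
by move=> i; apply: Qmono (Qf i); apply: le_bigmax_cond.
Qed.

End FinUniform.

Lemma pigeonhole (T : finType) (f : nat -> T) : exists i j, (i < j)%N /\ f i = f j.
Proof.
apply: contrapT => none.
have inj : injective (fun i : 'I_#|T|.+1 => f i).
  move=> i j fij; apply/val_inj; case: (ltngtP i j) => // ij; case: none.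
    by exists i, j.
  by exists j, i.
by have := leq_card _ inj; rewrite card_ord ltnn.
Qed.

(** The cube of side [K + K] is cut into cells of side [eta]; colour and cell take finitely many
    values, so two indices agree on both. *)
Lemma bounded_close_pair (R : realType) (C : finType) (c : nat -> C) (n : nat)
    (u : nat -> 'I_n -> R) (K eta : R) : 0 < eta -> (forall k i, `|u k i| <= K) ->
  exists i j, [/\ (i < j)%N, c i = c j & forall l, `|u i l - u j l| < eta].
Proof.
move=> eta0 uK; pose q k l := Num.trunc ((u k l + K) / eta).
pose Q := Num.trunc ((K + K) / eta).
have pos k l : 0 <= (u k l + K) / eta.
  by apply: divr_ge0 (ltW eta0); have := uK k l; rewrite ler_norml; lra.
have qQ k l : (q k l < Q.+1)%N.
  rewrite ltnS; apply: Num.Theory.le_truncn; rewrite ler_pM2r ?invr_gt0//.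
  by have := uK k l; rewrite ler_norml; lra.
have [i [j [ij e]]] := pigeonhole _ (fun k => (c k, [ffun l => Ordinal (qQ k l)])).
exists i, j; split=> [//||l]; first by case: e.
have qE : q i l = q j l.
  by case: e => _ /ffunP/(_ l); rewrite !ffunE => -[].
have := Num.Theory.truncn_itv (pos i l); have := Num.Theory.truncn_itv (pos j l).
rewrite -/(q i l) -/(q j l) qE -natr1; set a := (q j l)%:R.
rewrite !ler_pdivlMr// !ltr_pdivrMr// => /andP[h1 h2] /andP[h3 h4].
by rewrite ltr_norml; apply/andP; split; lra.
Qed.

(** * Value functions and their domains *)

Section Instance.
Variables (R : realType) (P : MSP R).
Local Notation dd := (@dd_ R P).
Local Notation St := (@St_ R P).
Local Notation Sc := (@Sc_ R P).
Local Notation px := (@px_ R P).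
Local Notation nd := (@nd_ R P).
Local Notation qd := (@qd_ R P).
Local Notation pit := (@pit_ R P).
Local Notation cost := (@cost_ R P).
Local Notation bd := (@bd_ R P).
Local Notation piw := (@piw R P).
Local Notation dotb := (@dotb R P _).
Local Notation normb := (@normb R P _).
Local Notation subb := (@subb R P _).
Local Notation stagecon := (@stagecon R P).
Local Notation inY := (@inY R P).
Local Notation Ycomp := (@Ycomp R P).
Local Notation Vfun := (@Vfun R P).
Local Notation bfam d := (Sc -> 'cV[R]_(qd d)).
Local Notation notlast := (@notlast R P).
Local Notation LPopt := (@LPopt R P).
Local Notation LPfeas := (@LPfeas R P).
Local Notation LPval := (@LPval R P).
Local Notation UPopt := (@UPopt R P).
Local Notation UPfeas := (@UPfeas R P).
Local Notation UPval := (@UPval R P).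
Local Notation stobj := (@stobj R P).
Local Notation lc_th := (@lc_th R P _).
Local Notation lc_sig := (@lc_sig R P _).
Local Notation lc_nu := (@lc_nu R P _).
Local Notation lc_lam := (@lc_lam R P _).
Local Notation lc_x := (@lc_x R P _).
Local Notation lc_y := (@lc_y R P _).
Local Notation lc_b := (@lc_b R P _).
Local Notation UPoptFix := (@UPoptFix R P).
Local Notation My := (@My_ R P).
Local Notation uc_th := (@uc_th R P _).
Local Notation uc_y := (@uc_y R P _).
Local Notation uc_b := (@uc_b R P _).
Local Notation it_m := (@it_m R P).
Local Notation it_w := (@it_w R P).
Local Notation it_y := (@it_y R P).
Local Notation it_lv := (@it_lv R P).
Local Notation it_uv := (@it_uv R P).
Local Notation it_dhat := (@it_dhat R P).
Local Notation it_lc := (@it_lc R P).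
Local Notation it_uc := (@it_uc R P).

Definition plusb {d} (u v : bfam d) : bfam d := fun w => u w + v w.
Definition scaleb {d} (c : R) (u : bfam d) : bfam d := fun w => c *: u w.

Lemma dotbDl d (u v w : bfam d) : dotb (plusb u v) w = dotb u w + dotb v w.
Proof. by rewrite -big_split; apply: eq_bigr => i _; rewrite dotvDl. Qed.

Lemma dotbZl d c (u v : bfam d) : dotb (scaleb c u) v = c * dotb u v.
Proof. by rewrite mulr_sumr; apply: eq_bigr => i _; rewrite dotvZl. Qed.

Lemma dotbBr d (u v w : bfam d) : dotb w (subb u v) = dotb w u - dotb w v.
Proof. by rewrite -sumrB; apply: eq_bigr => i _; rewrite dotvBr. Qed.

Lemma normb_ge0 d (u : bfam d) : 0 <= normb u.
Proof. by apply: sumr_ge0 => w _; apply: norm1_ge0. Qed.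

Lemma normb_coord d (u : bfam d) w : norm1 (u w) <= normb u.
Proof. by rewrite /Defs.normb (bigD1 w)//= lerDl sumr_ge0// => v _; apply: norm1_ge0. Qed.

Lemma normb_eq0 d (u : bfam d) : normb u = 0 -> u = fun=> 0.
Proof.
move=> u0; apply: funext => w; apply: norm1_eq0.
by apply: le_anti; rewrite norm1_ge0 -u0 normb_coord.
Qed.

Lemma normbD d (u v : bfam d) : normb (plusb u v) <= normb u + normb v.
Proof. by rewrite -big_split; apply: ler_sum => i _; apply: norm1D. Qed.

Lemma normbZ d c (u : bfam d) : normb (scaleb c u) = `|c| * normb u.
Proof. by rewrite mulr_sumr; apply: eq_bigr => i _; apply: norm1Z. Qed.

Lemma norm_dotb d (u v : bfam d) : `|dotb u v| <= normb u * normb v.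
Proof.
apply: le_trans (ler_norm_sum _ _ _) _.
rewrite mulr_suml; apply: ler_sum => w _; apply: le_trans (norm_dotv _ _ _ _) _.
by apply: ler_wpM2l; [apply: norm1_ge0|apply: normb_coord].
Qed.

Arguments normb_ge0 {d}.
Arguments normb_coord {d}.
Arguments normbD {d}.
Arguments norm_dotb {d}.

(** * Affine functions of the previous decision and the data *)

Definition affVB p d (f : 'cV[R]_p * bfam d -> R) : Prop :=
  exists al be c, f = fun z => dotv al z.1 + dotb be z.2 + c.

(** The additional real coordinate is the height in an epigraph. *)
Definition affVBt p d (f : 'cV[R]_p * bfam d * R -> R) : Prop :=
  exists g a, affVB p d g /\ f = fun z => g z.1 + a * z.2.

Lemma affVB_affspace p d : affspace (affVB p d).
Proof.
have d0 v : dotb (fun=> 0 : 'cV[R]_(qd d)) v = 0.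
  by rewrite /Defs.dotb big1 // => w _; rewrite dotv0l.
split.
- move=> c; exists 0, (fun=> 0), c; apply: funext => z.
  by rewrite dotv0l d0 !add0r.
- move=> f g [a1 [b1 [c1 ->]]] [a2 [b2 [c2 ->]]].
  exists (a1 + a2), (plusb b1 b2), (c1 + c2); apply: funext => z.
  by rewrite dotvDl dotbDl; ring.
- move=> c f [a1 [b1 [c1 ->]]].
  exists (c *: a1), (scaleb c b1), (c * c1); apply: funext => z.
  by rewrite dotvZl dotbZl; ring.
Qed.

Lemma affVB_v p d i : affVB p d (fun z => z.1 i 0).
Proof.
exists (delta_mx i 0), (fun=> 0), 0; apply: funext => z.
rewrite addr0 [dotb _ _]big1 ?addr0 => [|w _]; last by rewrite dotv0l.
rewrite /dotv (bigD1 i)//= mxE !eqxx mul1r big1 ?addr0// => j /negPf ji.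
by rewrite mxE ji mul0r.
Qed.

Lemma affVB_b p d w i : affVB p d (fun z => z.2 w i 0).
Proof.
exists 0, (fun w' => if w' == w then delta_mx i 0 else 0), 0; apply: funext => z.
rewrite addr0 dotv0l add0r /Defs.dotb (bigD1 w)//= eqxx.
rewrite [X in _ + X]big1 => [|w' /negPf ->]; last by rewrite dotv0l.
rewrite addr0 /dotv (bigD1 i)//= mxE !eqxx mul1r big1 ?addr0// => j /negPf ji.
by rewrite mxE ji mul0r.
Qed.

Lemma affVBt_affspace p d : affspace (affVBt p d).
Proof.
have aff := affVB_affspace p d; split.
- move=> c; exists (fun=> c), 0; split; first exact: aff_cst.
  by apply: funext => z; rewrite mul0r addr0.
- move=> f1 f2 [g1 [a1 [P1 ->]]] [g2 [a2 [P2 ->]]].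
  exists (fun z => g1 z + g2 z), (a1 + a2); split; first exact: aff_add.
  by apply: funext => z; ring.
- move=> c f [g [a [Pg ->]]].
  exists (fun z => c * g z), (c * a); split; first exact: aff_scale.
  by apply: funext => z; ring.
Qed.

Lemma affVBt_vb p d f : affVB p d f -> affVBt p d (fun z => f z.1).
Proof. by move=> Pf; exists f, 0; split=> //; apply: funext => z; rewrite mul0r addr0. Qed.

Lemma affVBt_t p d : affVBt p d (fun z => z.2).
Proof.
exists (fun=> 0), 1; split; first exact: aff_cst (affVB_affspace p d) 0.
by apply: funext => z; rewrite add0r mul1r.
Qed.

Section StageAffine.
Variables (T : Type) (Phi : (T -> R) -> Prop).
Hypothesis aPhi : affspace Phi.

Lemma aff_mulmx m n (M : 'M[R]_(m, n)) (u : T -> 'cV[R]_n) i :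
  (forall k, Phi (fun z => u z k 0)) -> Phi (fun z => (M *m u z) i 0).
Proof.
move=> Pu; have -> : (fun z => (M *m u z) i 0) = fun z => \sum_k M i k * u z k 0.
  by apply: funext => z; rewrite mxE.
by apply: (aff_sum aPhi) => k; apply: (aff_scale aPhi).
Qed.

Lemma aff_dotv n (a : 'cV[R]_n) (u : T -> 'cV[R]_n) :
  (forall k, Phi (fun z => u z k 0)) -> Phi (fun z => dotv a (u z)).
Proof. by move=> Pu; apply: (aff_sum aPhi) => k; apply: (aff_scale aPhi). Qed.

Lemma aff_comp_affVB p d (f : 'cV[R]_p * bfam d -> R) (v : T -> 'cV[R]_p)
    (b : T -> bfam d) :
  affVB p d f -> (forall i, Phi (fun z => v z i 0)) ->
  (forall w i, Phi (fun z => b z w i 0)) -> Phi (fun z => f (v z, b z)).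
Proof.
move=> [al [be [c ->]]] Pv Pb /=.
apply: (aff_add aPhi); last exact: (aff_cst aPhi).
apply: (aff_add aPhi); first exact: aff_dotv.
by apply: (aff_sum aPhi) => w; apply: aff_dotv.
Qed.

Lemma inY_polyhedral d (y : T -> Sc -> 'cV[R]_(nd d)) :
  (forall w i, Phi (fun z => y z w i 0)) -> polyhedral Phi (fun z => inY d (y z)).
Proof.
move=> Py; apply: polyhedral_forall => i; apply: polyhedral_forall => j.
rewrite (ord1 j); apply: (polyhedral_le aPhi); last exact: aff_cst.
have -> : (fun z => (\sum_w Gmat_ R P d w *m y z w) i 0) =
          (fun z => \sum_w (Gmat_ R P d w *m y z w) i 0).
  by apply: funext => z; rewrite summxE.
by apply: (aff_sum aPhi) => w; apply: aff_mulmx.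
Qed.

Lemma stagecon_polyhedral d x (v : T -> 'cV[R]_(nd d.-1)) (b : T -> bfam d)
    (y : T -> Sc -> 'cV[R]_(nd d)) :
  (forall i, Phi (fun z => v z i 0)) -> (forall w i, Phi (fun z => b z w i 0)) ->
  (forall w i, Phi (fun z => y z w i 0)) ->
  polyhedral Phi (fun z => stagecon d x (v z) (b z) (y z)).
Proof.
move=> Pv Pb Py; apply: polyhedral_and; first exact: inY_polyhedral.
apply: polyhedral_forall => w; apply: polyhedral_forall => i.
apply: polyhedral_forall => j; rewrite (ord1 j).
apply: (polyhedral_le aPhi); first exact: aff_mulmx.
have -> : (fun z => (bil R P d x (b z w) + Cmat_ R P d *m v z) i 0) =
   (fun z => (x^T *m Bmat_ R P d i *m b z w) 0 0 + (Cmat_ R P d *m v z) i 0).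
  by apply: funext => z; rewrite mxE [bil _ _ _ _ _ _ _]mxE.
by apply: (aff_add aPhi); apply: aff_mulmx.
Qed.

End StageAffine.
Arguments aff_dotv {T Phi}.
Arguments aff_comp_affVB {T Phi}.
Arguments inY_polyhedral {T Phi}.
Arguments stagecon_polyhedral {T Phi}.

Lemma LPval_le d m S x v b y th : LPfeas d m S x v b y th ->
  (LPval d m S x v b <= (stobj d m y th)%:E)%E.
Proof. by move=> feas; apply: ereal_inf_lbound; exists (y, th). Qed.

Lemma LPval_opt d m S x v b y th : LPopt d m S x v b y th ->
  LPval d m S x v b = (stobj d m y th)%:E.
Proof.
move=> [feas opt]; apply/eqP; rewrite eq_le LPval_le//=.
by apply/ereal_infP => _ [[y' th'] feas' <-]; rewrite lee_fin; apply: opt.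
Qed.

Lemma UPval_le d m S x v b y th gam zet mu : UPfeas d m S x v b y th gam zet mu ->
  (UPval d m S x v b <= (stobj d m y th)%:E)%E.
Proof. by move=> feas; apply: ereal_inf_lbound; exists (y, th, gam, zet, mu). Qed.

Lemma UPval_opt d m S x v b y th gam zet mu : UPopt d m S x v b y th gam zet mu ->
  UPval d m S x v b = (stobj d m y th)%:E.
Proof.
move=> [feas opt]; apply/eqP; rewrite eq_le (UPval_le _ _ _ _ _ _ _ _ _ _ _ feas)//=.
apply/ereal_infP => _ [[[[[y' th'] gam'] zet'] mu'] feas' <-]; rewrite lee_fin.
exact: (opt _ _ _ _ _ feas').
Qed.

Arguments LPval_le {d m S x v b y th}.
Arguments LPval_opt {d m S x v b y th}.
Arguments UPval_le {d m S x v b y th gam zet mu}.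
Arguments UPval_opt {d m S x v b y th gam zet mu}.

Definition nextle j d m x (y : Sc -> 'cV[R]_(nd d)) (th : Sc -> St -> R) : Prop :=
  match j with
  | 0 => True
  | j'.+1 => forall w n, (Vfun j' d.+1 n x (y w) (bd d.+1 m n) <= (th w n)%:E)%E
  end.

(** Unlike [stobj], this recognises the last stage by the fuel [j], as [Vfun] does. *)
Definition epiobj j d m (y : Sc -> 'cV[R]_(nd d)) (th : Sc -> St -> R) : R :=
  \sum_w piw * (dotv (cost d) (y w) +
     match j with 0 => 0 | _ => \sum_n pit d.+1 m n * th w n end).

Lemma piw_ge0 : 0 <= piw. Proof. by rewrite invr_ge0 ler0n. Qed.

(** Each constraint is affine in the height, with some slope [a]: raising the height by
    [e / (|a| + 1)] changes the constraint by at most [e], and [e] is arbitrary. *)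
Lemma affVBt_closed p d (S : 'cV[R]_p * bfam d * R -> Prop) z :
  polyhedral (affVBt p d) S ->
  (forall e, 0 < e -> S (z.1, z.2 + e)) -> S z.
Proof.
move=> [I [f [Pf fE]]] Se; apply/fE => i; have [g [a [_ fi]]] := Pf i.
rewrite fi; apply/ler_addgt0Pr => e e0; rewrite add0r.
have a1 : 0 < `|a| + 1 by rewrite ltr_wpDl.
have /fE/(_ i) := Se (e / (`|a| + 1)) (divr_gt0 e0 a1); rewrite fi /= => h.
have : - a * (e / (`|a| + 1)) <= e.
  rewrite mulrCA ger_pMr// ler_pdivrMr// mul1r.
  by apply: le_trans (ler_norm _) _; rewrite normrN lerDl.
lra.
Qed.

Section Standing.
Variable x : 'cV[R]_px.
Hypothesis stx : standing R P x.

Lemma pit_ge0 d l m : (2 <= d <= dd)%N -> 0 <= pit d l m.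
Proof. by move=> dd2; have [_ [_ [_ [_ [h _]]]]] := stx; apply: h. Qed.

Lemma V_fin d l m w v : (2 <= d.+1 <= dd)%N -> Ycomp d w v ->
  V R P d.+1 m x v (bd d.+1 l m) \is a fin_num.
Proof.
by move=> d2 Yv; have [_ [_ [_ [_ [_ [_ [_ [_ [h _]]]]]]]]] := stx; apply: (h _ d2 l m w v Yv).
Qed.

Lemma Vfun_le_epi j d m v b y th : (j + d)%N = dd -> (1 <= d)%N ->
  stagecon d x v b y -> nextle j d m x y th ->
  (Vfun j d m x v b <= (epiobj j d m y th)%:E)%E.
Proof.
move=> jd d1 yc yth; have := piw_ge0; rewrite -lee_fin => pw0.
case: j jd yth => [|j] jd yth /=.
  apply: ereal_inf_lbound; exists y => //.
  rewrite /epiobj -sumEFin; apply: eq_bigr => w _.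
  by rewrite !addr0.
apply: le_trans (ereal_inf_lbound _) _; first by exists y; first exact: yc.
rewrite /epiobj -sumEFin; apply: lee_sum => w _.
rewrite EFinM EFinD; apply: lee_wpmul2l => //; apply: leeD2l.
rewrite -sumEFin; apply: lee_sum => n _; rewrite EFinM; apply: lee_wpmul2l => //.
by rewrite lee_fin pit_ge0// ltnS d1 -jd addSnnS leq_addl.
Qed.

Lemma Vfun_epi_near j d m v b t e : (j + d)%N = dd -> (1 <= d)%N -> 0 < e ->
  (Vfun j d m x v b <= t%:E)%E ->
  exists y th, [/\ stagecon d x v b y, nextle j d m x y th & epiobj j d m y th <= t + e].
Proof.
move=> jd d1 e0 Vt.
have : (Vfun j d m x v b < (t + e)%:E)%E.
  by apply: le_lt_trans Vt _; rewrite lte_fin ltrDl.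
case: j jd {Vt} => [|j] jd /= /ereal_inf_lt[_ [y yc <-]] /ltW.
  move=> h; exists y, (fun _ _ => 0); split=> //.
  rewrite -lee_fin; apply: le_trans h.
  rewrite /epiobj -sumEFin; apply: lee_sum => w _.
  by rewrite !addr0.
move=> h; exists y, (fun w n => fine (Vfun j d.+1 n x (y w) (bd d.+1 m n))).
have fin w n : Vfun j d.+1 n x (y w) (bd d.+1 m n) \is a fin_num.
  have d2 : (2 <= d.+1 <= dd)%N by rewrite ltnS d1 -jd addSnnS leq_addl.
  have jE : j = (dd - d.+1)%N by rewrite -jd addSnnS addnK.
  by rewrite jE; apply: (V_fin d m n w) => //; exists y; case: yc.
split=> //; first by move=> w n; rewrite fineK.
rewrite -lee_fin; apply: le_trans h; rewrite /epiobj -sumEFin; apply: lee_sum => w _.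
rewrite EFinM EFinD; apply: lee_wpmul2l; first by rewrite lee_fin piw_ge0.
by apply: leeD2l; rewrite -sumEFin; apply: lee_sum => n _; rewrite EFinM fineK.
Qed.

Lemma polyhedral_comp T (Phi : (T -> R) -> Prop) p d S (v : T -> 'cV[R]_p)
    (b : T -> bfam d) (t : T -> R) :
  affspace Phi -> polyhedral (affVBt p d) S ->
  (forall i, Phi (fun z => v z i 0)) -> (forall w i, Phi (fun z => b z w i 0)) ->
  Phi t -> polyhedral Phi (fun z => S (v z, b z, t z)).
Proof.
move=> aPhi [I [f [Pf fE]]] Pv Pb Pt.
exists I, (fun i z => f i (v z, b z, t z)); split=> [i|z]; last exact: fE.
have [g [a [Pg ->]]] := Pf i; apply: (aff_add aPhi).
  exact: (aff_comp_affVB aPhi).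
exact: (aff_scale aPhi).
Qed.

(* The epigraph of a stage is the projection of a polyhedron built from the
   epigraphs of the next stage; being polyhedral, it is closed, so that the
   infimum defining the value function is attained. *)
Lemma epigraph_polyhedral j d m : (j + d)%N = dd -> (1 <= d)%N ->
  (forall T (Phi : (T -> R) -> Prop) (y : T -> Sc -> 'cV[R]_(nd d)) (th : T -> Sc -> St -> R),
     affspace Phi ->
     (forall w i, Phi (fun z => y z w i 0)) -> (forall w n, Phi (fun z => th z w n)) ->
     polyhedral Phi (fun z => nextle j d m x (y z) (th z))) ->
  polyhedral (affVBt (nd d.-1) d) (fun z => (Vfun j d m x z.1.1 z.1.2 <= z.2%:E)%E).
Proof.
move=> jd d1 Pnext.
(* The variables to project out: the entries of the decision, and one height for each scenario and
   next state. *)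
pose K : finType := ((Sc * 'I_(nd d)) + (Sc * St))%type.
pose yof (u : K -> R) (w : Sc) : 'cV[R]_(nd d) := \col_i u (inl (w, i)).
pose tof (u : K -> R) (w : Sc) (n : St) : R := u (inr (w, n)).
pose Q z := exists u : K -> R, [/\ stagecon d x z.1.1 z.1.2 (yof u),
  nextle j d m x (yof u) (tof u) & epiobj j d m (yof u) (tof u) <= z.2].
pose Phi := affVBt (nd d.-1) d.
have aff : affspace Phi := affVBt_affspace _ _.
have affK := affext_affspace aff K.
have PQ : polyhedral Phi Q.
  apply: (polyhedral_exists aff).
  have Py w i : affext Phi K (fun zu => yof zu.2 w i 0).
    rewrite (_ : (fun zu => _) = (fun zu => zu.2 (inl (w, i)))).
      exact: (affext_coord aff).
    by apply: funext => zu; rewrite mxE.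
  have Pt w n : affext Phi K (fun zu => tof zu.2 w n).
    exact: (affext_coord aff).
  have Pcon := stagecon_polyhedral affK d x (fun zu => zu.1.1.1) (fun zu => zu.1.1.2)
    (fun zu => yof zu.2) (fun i => affext_fst K _ (affVBt_vb _ _ _ (affVB_v _ _ i)))
    (fun w i => affext_fst K _ (affVBt_vb _ _ _ (affVB_b _ _ w i))) Py.
  have Pnx := Pnext _ _ (fun zu => yof zu.2) (fun zu => tof zu.2) affK Py Pt.
  have Pobj : polyhedral (affext Phi K)
      (fun zu => epiobj j d m (yof zu.2) (tof zu.2) <= zu.1.2).
    apply: (polyhedral_le affK); last exact: affext_fst (affVBt_t _ _).
    apply: (aff_sum affK) => w; apply: (aff_scale affK); apply: (aff_add affK).
      exact: (aff_dotv affK).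
    case: {+}j => [|j']; first exact: (aff_cst affK).
    by apply: (aff_sum affK) => n; apply: (aff_scale affK).
  apply: polyhedral_ext (polyhedral_and _ _ Pcon (polyhedral_and _ _ Pnx Pobj)) => zu.
  by split=> [[h1 [h2 h3]]|[h1 h2 h3]].
have Qle z : Q z -> (Vfun j d m x z.1.1 z.1.2 <= z.2%:E)%E.
  move=> [u [uc un uo]].
  by apply: le_trans (Vfun_le_epi j d m _ _ _ _ jd d1 uc un) _; rewrite lee_fin.
apply: (polyhedral_ext _ PQ) => z; split; first exact: Qle.
move=> Vz; apply: (affVBt_closed _ _ _ _ PQ) => e e0.
have [y [th [yc yn yo]]] := Vfun_epi_near j d m _ _ _ e jd d1 e0 Vz.
pose u (k : K) := match k with inl wi => y wi.1 wi.2 0 | inr wn => th wn.1 wn.2 end.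
have yu : yof u = y by apply: funext => w; apply/colP => i; rewrite mxE.
by exists u; rewrite yu; split.
Qed.

(** Backward induction: the next-stage constraints are preimages of the epigraphs of the following
    stage, taken at fixed data, under affine maps. *)
Lemma Vfun_polyhedral j d m : (j + d)%N = dd -> (1 <= d)%N ->
  polyhedral (affVBt (nd d.-1) d) (fun z => (Vfun j d m x z.1.1 z.1.2 <= z.2%:E)%E).
Proof.
elim: j d m => [|j IH] d m jd d1; apply: epigraph_polyhedral => // T Phi y th aPhi Py Pth /=.
  by exists void, (fun=> fun=> 0); split=> [[]|z]; split=> // _ [].
apply: polyhedral_forall => w; apply: polyhedral_forall => n.
have jd' : (j + d.+1)%N = dd by rewrite -addSnnS.
apply: (polyhedral_comp _ _ _ _ _ _ _ _ aPhi (IH d.+1 n jd' isT) (Py w) _ (Pth w n)).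
by move=> w' i; apply: (aff_cst aPhi).
Qed.

(** * Domains, subgradients and interior points *)

Lemma Dom_polyhedral d : polyhedral (affVB (nd d) d.+1)
  (fun z => exists y, stagecon d.+1 x z.1 z.2 y).
Proof.
pose K : finType := (Sc * 'I_(nd d.+1))%type.
pose yof (u : K -> R) (w : Sc) : 'cV[R]_(nd d.+1) := \col_i u (w, i).
pose Phi := affVB (nd d) d.+1.
have aff : affspace Phi := affVB_affspace _ _.
have affK := affext_affspace aff K.
have Py w i : affext Phi K (fun zu => yof zu.2 w i 0).
  rewrite (_ : (fun zu => _) = (fun zu => zu.2 (w, i))).
    exact: (affext_coord aff).
  by apply: funext => zu; rewrite mxE.
have Pcon := stagecon_polyhedral affK d.+1 x (fun zu => zu.1.1) (fun zu => zu.1.2)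
  (fun zu => yof zu.2) (fun i => affext_fst K _ (affVB_v _ _ i))
  (fun w i => affext_fst K _ (affVB_b _ _ w i)) Py.
apply: polyhedral_ext (polyhedral_exists aff K
  (fun z u => stagecon d.+1 x z.1 z.2 (yof u)) Pcon) => z.
split=> [[u uc]|[y yc]]; first by exists (yof u).
have yu : yof (fun k => y k.1 k.2 0) = y.
  by apply: funext => w; apply/colP => i; rewrite mxE.
by exists (fun k => y k.1 k.2 0); rewrite yu.
Qed.

Lemma V_pinfty d m v b : ~ (exists y, stagecon d x v b y) -> V R P d m x v b = +oo%E.
Proof.
move=> noy; rewrite /V; case: (dd - d)%N => [|j] /=; rewrite -[RHS]ereal_inf0; congr ereal_inf.
all: by apply/seteqP; split=> // r [y yc _]; case: noy; exists y.
Qed.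

(** Constraints with [a >= 0] survive any lowering of the height. If each of the finitely many
    others had room at [z], a common small lowering would respect them all. *)
Lemma affVBt_active (p d : nat) (S : 'cV[R]_p * bfam d * R -> Prop) z :
  polyhedral (affVBt p d) S -> S z -> (forall e, 0 < e -> ~ S (z.1, z.2 - e)) ->
  exists g a, [/\ affVB p d g, a < 0, g z.1 + a * z.2 = 0 &
    forall z', S z' -> g z'.1 + a * z'.2 <= 0].
Proof.
move=> [I [f [Pf fE]]] Sz noS; apply: contrapT => none.
have [i r s /andP[s0 sr] /=|i|e e0 He] := fin_uniform_lb R I (fun i e => f i (z.1, z.2 - e) <= 0).
- have [g [a [Pg fi]]] := Pf i; have /fE/(_ i) := Sz; rewrite fi /= => h1 h2.
  have [a0|a0] := leP 0 a; first by have := mulr_ge0 a0 (ltW s0); lra.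
  have : a * r <= a * s by rewrite ler_nM2l.
  lra.
- have [g [a [Pg fi]]] := Pf i; have /fE/(_ i) := Sz; rewrite fi /= => h1.
  have [a0|a0] := leP 0 a; first by exists 1 => //; lra.
  have [h0|h0] := eqVneq (g z.1 + a * z.2) 0.
    case: none; exists g, a; split=> // z' /fE/(_ i); by rewrite fi.
  have hlt : g z.1 + a * z.2 < 0 by rewrite lt_neqAle h0.
  exists ((g z.1 + a * z.2) / a); first by rewrite ltr_ndivlMr// mul0r.
  rewrite mulrBr [a * (_ / a)]mulrC divfK ?lt_eqF//; lra.
by apply: (noS e e0); apply/fE.
Qed.

(** The constraint active at the lowest point of the epigraph over [(v, b)], divided by [- a], is an
    affine minorant touching there. This gives a subgradient jointly in both arguments. *)
Lemma V_subgradient d l m w v : (2 <= d.+1 <= dd)%N -> Ycomp d w v ->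
  exists g h, forall v' b', (V R P d.+1 m x v (bd d.+1 l m) +
     (dotv g (v' - v) + dotb h (subb b' (bd d.+1 l m)))%:E <= V R P d.+1 m x v' b')%E.
Proof.
move=> d2 Yv; have Vfin := V_fin d l m w v d2 Yv; set b := bd d.+1 l m in Vfin *.
have jd : ((dd - d.+1) + d.+1 = dd)%N by rewrite subnK//; case/andP: d2.
have Ppoly := Vfun_polyhedral (dd - d.+1) d.+1 m jd isT.
case/(affVBt_active _ _ _ (v, b, fine (V R P d.+1 m x v b))): Ppoly => /=.
- by rewrite fineK.
- move=> e e0 /=; rewrite -/(V R P d.+1 m x v b) => h.
  have : ((fine (V R P d.+1 m x v b))%:E <= (fine (V R P d.+1 m x v b) - e)%:E)%E by rewrite fineK.
  by rewrite lee_fin; lra.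
move=> _ [a [[al [be [c ->]]] a0 /= z0 zS]].
exists ((- a)^-1 *: al), (scaleb (- a)^-1 be) => v' b'.
have na0 : 0 < - a by rewrite oppr_gt0.
have key t : (V R P d.+1 m x v' b' <= t%:E)%E ->
    fine (V R P d.+1 m x v b) + (- a)^-1 * (dotv al (v' - v) + dotb be (subb b' b)) <= t.
  move=> /(zS (v', b', t)) /= h.
  rewrite -lerBrDl mulrC ler_pdivrMr// dotvBr dotbBr; lra.
rewrite -[X in (X + _)%E](fineK Vfin) -EFinD dotvZl dotbZl -mulrDr.
case: (V R P d.+1 m x v' b') key => [r| |] key.
- by rewrite lee_fin; apply: key; rewrite lexx.
- by rewrite leey.
(* The value [-oo] would lie below every [t], in particular below one that violates [key]. *)
- have := key (fine (V R P d.+1 m x v b) + (- a)^-1 * (dotv al (v' - v) + dotb be (subb b' b)) - 1).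
  by move=> /(_ (leNye _)); rewrite lerDl oppr_ge0 ler10.
Qed.

(** Used with [n] the norm of a normal and [s] that of a subgradient: a bounded ray has zero
    direction. *)
Lemma ray_bounded (c n s : R) : 0 <= n -> (forall t, 0 <= t -> t * n - s <= c) -> n = 0.
Proof.
move=> n0 h; apply/eqP; rewrite eq_le n0 andbT leNgt; apply/negP => np.
have := h ((`|c| + `|s| + 1) / n) (divr_ge0 _ n0); rewrite divfK ?gt_eqF// => h1.
have := h1 (addr_ge0 (addr_ge0 (normr_ge0 c) (normr_ge0 s)) ler01).
by have := ler_norm c; have := ler_norm s; lra.
Qed.

(* A normal of the domain of [V] can be added to any subgradient any number
   of times, so the bounds on the subgradients exclude nonzero normals. *)
Lemma Dom_normal0 d l m w v al be : (2 <= d.+1 <= dd)%N -> Ycomp d w v ->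
  (forall v' b', (exists y, stagecon d.+1 x v' b' y) ->
     dotv al (v' - v) + dotb be (subb b' (bd d.+1 l m)) <= 0) ->
  al = 0 /\ be = fun=> 0.
Proof.
move=> d2 Yv normal; have Vfin := V_fin d l m w v d2 Yv.
have [g [h sub]] := V_subgradient d l m w v d2 Yv.
have [_ [_ [_ [_ [_ [_ [_ [_ [_ [_ [_ bnd]]]]]]]]]]] := stx.
have [bndy bndb] := bnd _ d2 l m w v Yv => {bnd}.
set b := bd d.+1 l m in normal sub bndy bndb Vfin.
(* Off the domain the right-hand side is [+oo]; on it the added multiple of the normal contributes a
   nonpositive amount. *)
have sub' t v' b' : 0 <= t -> (V R P d.+1 m x v b +
    (dotv (g + t *: al) (v' - v) + dotb (plusb h (scaleb t be)) (subb b' b))%:E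
      <= V R P d.+1 m x v' b')%E.
  move=> t0; have [D|/V_pinfty ->] := pselect (exists y, stagecon d.+1 x v' b' y); last exact: leey.
  apply: le_trans (sub v' b'); apply: leeD2l; rewrite lee_fin dotvDl dotvZl dotbDl dotbZl.
  have := mulr_ge0_le0 t0 (normal v' b' D); lra.
have sbb u : dotb u (subb b b) = 0 by rewrite dotbBr subrr.
(* The assumed bounds concern partial subgradients, so each component is treated with the other
   argument kept fixed. *)
split.
- apply: norm1_eq0; apply: (ray_bounded (My_ R P) _ (norm1 g)) => [|t t0]; first exact: norm1_ge0.
  have -> : t * norm1 al = norm1 (t *: al) by rewrite norm1Z ger0_norm.
  have -> : t *: al = (g + t *: al) - g by rewrite addrC addKr.
  rewrite lerBlDr; apply: le_trans (norm1B _ _ _ _) _; rewrite lerD2r.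
  apply: bndy => v'; have := sub' t v' b t0.
  by rewrite sbb addr0.
- apply: normb_eq0; apply: (ray_bounded (Mb_ R P) _ (normb h)) => [|t t0]; first exact: normb_ge0.
  have -> : t * normb be = normb (scaleb t be) by rewrite normbZ ger0_norm.
  have -> : scaleb t be = plusb (plusb h (scaleb t be)) (scaleb (-1) h).
    by apply: funext => u; rewrite /plusb /scaleb scaleN1r addrC addKr.
  rewrite lerBlDr; apply: le_trans (normbD _ _) _.
  rewrite normbZ normrN1 mul1r lerD2r.
  apply: bndb => b'; have := sub' t v b' t0.
  by rewrite subrr dotv0r add0r.
Qed.

(** The values of the affine function, with all numbers below them, form a polyhedron in the line.
    It misses 0, so 0 violates one of its constraints, and this constraint keeps all the values a
    fixed distance away from 0. *)
Lemma inY_slack d w (al : 'cV[R]_(nd d)) c :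
  (forall y, inY d y -> dotv al (y w) + c < 0) ->
  exists2 s, 0 < s & forall y, inY d y -> dotv al (y w) + c + s <= 0.
Proof.
move=> neg.
pose Phi (f : R -> R) := exists a e, f = fun t => a * t + e.
have aff : affspace Phi.
  split.
  - by move=> e; exists 0, e; apply: funext => t; rewrite mul0r add0r.
  - move=> _ _ [a1 [e1 ->]] [a2 [e2 ->]]; exists (a1 + a2), (e1 + e2).
    by apply: funext => t; ring.
  - move=> e _ [a1 [e1 ->]]; exists (e * a1), (e * e1); apply: funext => t; ring.
pose K : finType := (Sc * 'I_(nd d))%type.
pose yof (u : K -> R) (w : Sc) : 'cV[R]_(nd d) := \col_i u (w, i).
have affK := affext_affspace aff K.
have Py w' i : affext Phi K (fun zu => yof zu.2 w' i 0).
  rewrite (_ : (fun zu => _) = (fun zu => zu.2 (w', i))).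
    exact: (affext_coord aff).
  by apply: funext => zu; rewrite mxE.
have PY := inY_polyhedral affK d (fun zu => yof zu.2) Py.
have Pt : Phi (fun t => t) by exists 1, 0; apply: funext => t; rewrite mul1r addr0.
have Pobj : polyhedral (affext Phi K) (fun zu => zu.1 <= dotv al (yof zu.2 w) + c).
  apply: (polyhedral_le affK); first exact: affext_fst Pt.
  by apply: (aff_add affK); [apply: (aff_dotv affK)|apply: (aff_cst affK)].
have [I [f [Pf fE]]] := polyhedral_exists aff K
  (fun t u => inY d (yof u) /\ t <= dotv al (yof u w) + c) (polyhedral_and _ _ PY Pobj).
have [i fi0] : exists i, 0 < f i 0.
  apply: contrapT => none; have /fE[u [Yu]] : forall i, f i 0 <= 0.
    by move=> i; rewrite leNgt; apply/negP => h; apply: none; exists i.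
  by have := neg _ Yu; lra.
have [a [e fiE]] := Pf i; move: fi0; rewrite fiE mulr0 add0r => e0.
have bound y : inY d y -> a * (dotv al (y w) + c) + e <= 0.
  move=> Yy; have /fE/(_ i) : exists u, inY d (yof u) /\ dotv al (y w) + c <= dotv al (yof u w) + c.
    exists (fun k => y k.1 k.2 0).
    have -> : yof (fun k => y k.1 k.2 0) = y.
      by apply: funext => w'; apply/colP => k; rewrite mxE.
    by split.
  by rewrite fiE.
have [a0|a0] := ltP 0 a.
  exists (e / a) => [|y Yy]; first exact: divr_gt0.
  by rewrite -(pmulr_rle0 _ a0) mulrDr [a * (e / a)]mulrC divfK ?gt_eqF// bound.
(* With [a <= 0] the constraint fails at every negative number, so there is no such [y] and any
   slack will do. *)
exists 1 => // y Yy; have := bound y Yy.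
have := mulr_le0 a0 (ltW (neg y Yy)); lra.
Qed.

(** Of the finitely many constraints of the domain, one that is active at an admissible point has a
    normal as its gradient, so the gradient is zero and the constraint holds everywhere. One that is
    active at no admissible point has a uniform slack there. *)
Lemma Dom_interior d : (2 <= d.+1 <= dd)%N ->
  exists2 r, 0 < r & forall l m w v, Ycomp d w v -> forall v' b',
    norm1 (v' - v) <= r -> normb (subb b' (bd d.+1 l m)) <= r ->
    exists y, stagecon d.+1 x v' b' y.
Proof.
move=> d2; have [I [f [Pf fE]]] := Dom_polyhedral d.
have YDom l m w v : Ycomp d w v -> exists y, stagecon d.+1 x v (bd d.+1 l m) y.
  move=> Yv; apply: contrapT => /(V_pinfty _ m) Voo.
  by have := V_fin d l m w v d2 Yv; rewrite Voo.
pose Q (k : (St * St) * (Sc * I)) r := forall v, Ycomp d k.2.1 v -> forall v' b',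
    norm1 (v' - v) <= r -> normb (subb b' (bd d.+1 k.1.1 k.1.2)) <= r ->
    f k.2.2 (v', b') <= 0.
have [k r s /andP[_ sr] Qr v Yv v' b' h1 h2|k|r r0 Qr] := fin_uniform_lb R _ Q.
- by apply: (Qr v Yv); [apply: le_trans h1 sr|apply: le_trans h2 sr].
- case: k => -[l m] [w i]; have [al [be [c fi]]] := Pf i.
  have move_to v v' b' : f i (v', b') = f i (v, bd d.+1 l m) +
      (dotv al (v' - v) + dotb be (subb b' (bd d.+1 l m))).
    by rewrite fi /= dotvBr dotbBr; ring.
  have [[v [Yv fi0]]|none] := pselect (exists v, Ycomp d w v /\ f i (v, bd d.+1 l m) = 0).
    have [] := Dom_normal0 d l m w v al be d2 Yv.
      by move=> v' b' /(fE (v', b'))/(_ i); rewrite (move_to v) fi0 add0r.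
    move=> al0 be0; exists 1 => // v1 Yv1 v' b' _ _ /=.
    rewrite (move_to v) fi0 al0 be0 dotv0l !add0r [dotb _ _]big1// => u _.
    by rewrite dotv0l.
  have [y Yy|s s0 slack] := inY_slack d w al (dotb be (bd d.+1 l m) + c).
    rewrite addrA.
    have /(fE (_, _))/(_ i) : exists y', stagecon d.+1 x (y w) (bd d.+1 l m) y'.
      by apply: (YDom l m w); exists y.
    rewrite fi /= le_eqVlt => /orP[/eqP h|//]; case: none; exists (y w).
    by split; [exists y|rewrite fi].
  have nab : 0 < norm1 al + normb be + 1.
    by rewrite ltr_wpDl// addr_ge0 ?norm1_ge0 ?normb_ge0.
  (* Within this radius the constraint varies by at most the slack [s]; the summand 1 avoids a zero
     denominator. *)
  exists (s / (norm1 al + normb be + 1)); first exact: divr_gt0.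
  move=> v [y [Yy yv]] v' b' /=; rewrite !ler_pdivlMr// => h1 h2.
  rewrite (move_to v) fi /= -yv.
  have := slack y Yy.
  have := norm_dotv _ _ al (v' - v); have := norm_dotb be (subb b' (bd d.+1 l m)).
  have := ler_norm (dotv al (v' - v)); have := ler_norm (dotb be (subb b' (bd d.+1 l m))).
  have := norm1_ge0 _ _ (v' - v); have := normb_ge0 (subb b' (bd d.+1 l m)).
  move: (norm1_ge0 _ _ al) (normb_ge0 be) h1 h2.
  rewrite -yv; set A := norm1 al; set B := normb be; set n := norm1 _; set p := normb _.
  set D := dotv _ _; set E := dotb _ _; move=> A0 B0 h1 h2 p0 n0 E1 D1 E2 D2 sl.
  have : A * n + B * p <= s; last by lra.
  have AB : 0 < A + B + 1 by [].
  have n1 : n <= s / (A + B + 1) by rewrite ler_pdivlMr.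
  have p1 : p <= s / (A + B + 1) by rewrite ler_pdivlMr.
  have := ler_wpM2l A0 n1; have := ler_wpM2l B0 p1.
  have : s / (A + B + 1) * (A + B + 1) = s by rewrite divfK ?gt_eqF.
  have : 0 < s / (A + B + 1) by apply: divr_gt0.
  by set q := s / _; lra.
exists r => // l m w v Yv v' b' h1 h2; apply/(fE (v', b')) => i.
exact: (Qr (l, m, (w, i)) v).
Qed.

(** * Boundedness of the cuts *)

Lemma sum_piw : \sum_(w : Sc) piw = 1.
Proof.
have [_ [Sc0 _]] := stx.
by rewrite sumr_const -[RHS](mulVf (x := #|Sc|%:R)) ?pnatr_eq0 -?lt0n// mulr_natr.
Qed.

Lemma avg_piw_le (F : Sc -> R) B : (forall w, F w <= B) -> \sum_w piw * F w <= B.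
Proof.
move=> FB; rewrite -[leRHS]mul1r -sum_piw mulr_suml; apply: ler_sum => w _.
by apply: ler_wpM2l => //; apply: piw_ge0.
Qed.

Lemma avg_pit_le d m (F : St -> R) B : (2 <= d <= dd)%N ->
  (forall n, 0 < pit d m n -> F n <= B) -> \sum_n pit d m n * F n <= B.
Proof.
move=> d2 FB; have [_ [_ [_ [_ [_ [sum1 _]]]]]] := stx.
rewrite -[leRHS]mul1r -(sum1 d d2 m) mulr_suml; apply: ler_sum => n _.
have := pit_ge0 d m n d2; rewrite le_eqVlt => /predU1P[<-|p0]; first by rewrite !mul0r.
by rewrite ler_pM2l// FB.
Qed.

Lemma stobj_le d m y th A B : (1 <= d)%N -> 0 <= B ->
  (forall w, dotv (cost d) (y w) <= A) ->
  (notlast d -> forall w n, 0 < pit d.+1 m n -> th w n <= B) -> stobj d m y th <= A + B.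
Proof.
move=> d1 B0 cA thB; apply: avg_piw_le => w; apply: lerD => //.
by case: ifP thB => // dl /(_ isT w) thB; apply: avg_pit_le => //; rewrite ltnS d1.
Qed.

Lemma stobj_ge d m y th A B : (1 <= d)%N -> 0 <= B ->
  (forall w, - A <= dotv (cost d) (y w)) ->
  (notlast d -> forall w n, 0 < pit d.+1 m n -> - B <= th w n) -> - (A + B) <= stobj d m y th.
Proof.
move=> d1 B0 cA thB; rewrite lerNl -sumrN.
under eq_bigr => w _ do rewrite -mulrN.
apply: avg_piw_le => w; rewrite opprD; apply: lerD; first by rewrite lerNl.
case: ifP thB => [dl /(_ isT w) thB|_ _]; last by rewrite oppr0.
rewrite -sumrN; under eq_bigr => n _ do rewrite -mulrN.
by apply: avg_pit_le => [|n /thB]; [rewrite ltnS d1|rewrite lerNl].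
Qed.

Lemma stobj_sub d m y th th' : notlast d ->
  stobj d m y th - stobj d m y th' =
  \sum_w piw * \sum_n pit d.+1 m n * (th w n - th' w n).
Proof.
move=> dl; rewrite -sumrB; apply: eq_bigr => w _; rewrite dl -mulrBr; congr (_ * _).
rewrite opprD addrACA subrr add0r -sumrB.
by apply: eq_bigr => n _; rewrite mulrBr.
Qed.

Lemma stobj_gap_le d m y th th' B : (1 <= d)%N -> notlast d ->
  (forall w n, 0 < pit d.+1 m n -> th w n - th' w n <= B) ->
  stobj d m y th - stobj d m y th' <= B.
Proof.
move=> d1 dl thB; rewrite stobj_sub//; apply: avg_piw_le => w.
by apply: avg_pit_le => [|n]; [rewrite ltnS d1|apply: thB].
Qed.

(* Without cuts for a state of positive probability, its variable could be
   decreased without bound. *)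
Lemma LPopt_nonempty d m S v b y th n : LPopt d m S x v b y th -> notlast d ->
  0 < pit d.+1 m n -> (0 < size (S n))%N.
Proof.
move=> [[yc cuts] opt] dl pn; rewrite lt0n; apply/negP => /eqP S0.
pose th' w n' := th w n' - (n' == n)%:R.
have : stobj d m y th <= stobj d m y th'.
  apply: opt; split=> // _ w n' i; rewrite /th'; case: eqP => [->|_]; first by rewrite S0.
  by rewrite subr0; apply: cuts.
apply/negP; rewrite -ltNge -subr_gt0 stobj_sub//.
have -> : \sum_w piw * \sum_n0 pit d.+1 m n0 * (th w n0 - th' w n0) = pit d.+1 m n.
  rewrite -[RHS]mul1r -sum_piw mulr_suml; apply: eq_bigr => w _; congr (_ * _).
  rewrite (bigD1 n)//= /th' eqxx subKr mulr1 big1 ?addr0// => n' /negPf ->.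
  by rewrite subr0 subrr mulr0.
by [].
Qed.

Lemma Y_bound d : (1 <= d <= dd)%N ->
  exists2 K, 0 <= K & forall y w, inY d y -> norm1 (y w) <= K.
Proof.
move=> d1; have [_ [_ [_ [_ [_ [_ [h _]]]]]]] := stx; have [K hK] := h d d1.
exists `|K| => // y w Yy; apply: le_trans (hK y Yy w) (ler_norm K).
Qed.

Lemma piw_gt0 : 0 < piw.
Proof. by have [_ [Sc0 _]] := stx; rewrite invr_gt0 ltr0n. Qed.

(* Putting all the weight on one stored point is feasible, and the variables
   [th w n] of an optimal solution are minimal separately. *)
Lemma UPoptFix_le d m S v b y th gam zet mu w n i :
  UPoptFix d m S x v b y th gam zet mu -> notlast d -> 0 < pit d.+1 m n ->
  (i < size (S n))%N -> uc_b (nth (ucut0 R P d) (S n) i) = bd d.+1 m n ->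
  th w n <= uc_th (nth (ucut0 R P d) (S n) i) +
            My * norm1 (uc_y (nth (ucut0 R P d) (S n) i) - y w).
Proof.
move=> [[yc feas] opt] dl pn si; set c := nth _ _ _ => cb.
set B := _ + _; pose here w' n' := (w' == w) && (n' == n).
pose th' w' n' := if here w' n' then B else th w' n'.
pose gam' w' n' := if here w' n' then uc_y c - y w else gam w' n'.
pose zet' w' n' := if here w' n' then fun=> 0 else zet w' n'.
pose mu' w' n' j := if here w' n' then (j == i)%:R else mu w' n' j : R.
have pickr (F : nat -> R) : \sum_(j < size (S n)) ((j : nat) == i)%:R * F j = F i.
  rewrite (bigD1 (Ordinal si))//= eqxx mul1r big1 ?addr0// => j ji.
  by rewrite (negPf (_ : (j : nat) != i)) ?mul0r.
have pickv p (F : nat -> 'cV[R]_p) : \sum_(j < size (S n)) ((j : nat) == i)%:R *: F j = F i.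
  rewrite (bigD1 (Ordinal si))//= eqxx scale1r big1 ?addr0// => j ji.
  by rewrite (negPf (_ : (j : nat) != i)) ?scale0r.
have feas' : UPfeas d m S x v b y th' gam' zet' mu'.
  split=> // _ w' n'; rewrite /th' /gam' /zet' /mu' /here.
  case: eqVneq => [->|_] /=; last exact: feas.
  case: eqVneq => [->|_] /=; last exact: feas.
  split; first by move=> j _; rewrite ler0n.
  split; first rewrite (pickr (fun j => uc_th (nth (ucut0 R P d) (S n) j))) -/c.
    rewrite [X in _ + _ * X]big1 ?mulr0 ?addr0// => u _; exact: norm10.
  split; first by rewrite (pickv _ (fun j => uc_y (nth (ucut0 R P d) (S n) j))) -/c addrC subrK.
  split=> [u|].
    by rewrite (pickv _ (fun j => uc_b (nth (ucut0 R P d) (S n) j) u)) -/c cb addr0.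
  by rewrite -[RHS](pickr (fun=> 1)); apply: eq_bigr => j _; rewrite mulr1.
(* Only the variables of the pair [(w, n)] have changed, and it has the positive weight
   [piw * pit d.+1 m n]. *)
have := opt _ _ _ _ feas'; rewrite -subr_ge0 stobj_sub//.
have -> : \sum_w0 piw * \sum_n0 pit d.+1 m n0 * (th' w0 n0 - th w0 n0) =
          piw * pit d.+1 m n * (B - th w n).
  rewrite (bigD1 w)//= [X in _ + X]big1 => [|w' /negPf w'w]; last first.
    rewrite big1 ?mulr0// => n' _; rewrite /th' /here w'w /= subrr mulr0//.
  rewrite addr0 (bigD1 n)//= [X in _ + X]big1 => [|n' /negPf n'n]; last first.
    by rewrite /th' /here n'n andbF subrr mulr0.
  by rewrite addr0 /th' /here !eqxx mulrA.
by rewrite pmulr_rge0 ?mulr_gt0 ?piw_gt0// subr_ge0.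
Qed.

Section Run.
Variables (delta : R) (L0 : lcolls R P) (U0 : ucolls R P) (its : nat -> itdata R P).
Hypothesis allOK : forall k, IterOK R P x delta (Lk R P L0 its k) (Uk R P U0 its k)
  (prevgap R P x L0 U0 its k) (its k).

(** The previous decision and the data are left existential, so that stage 1, with [0] and [b1_], is
    treated like the others. *)
Lemma iter_stage k d : let it := its k in (1 <= d <= it_dhat it)%N ->
  exists v b, LPopt d (it_m it d) (Lk R P L0 its k d (it_m it d)) x v b
                (it_y it d) (it_lv it d.+1) /\
   ((d < dd)%N -> exists gam zet mu,
      UPoptFix d (it_m it d) (Uk R P U0 its k d (it_m it d)) x v b
                (it_y it d) (it_uv it d.+1) gam zet mu).
Proof.
move=> it; have [_ [opt1 [up1 [_ [stg _]]]]] := allOK k.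
case: d => [//|[|d]] /andP[_ dh]; first by exists 0, (b1_ R P (it_m it 1%N)); split.
by have [_ [_ [_ [h1 h2]]]] := stg d.+2 dh; do 2 eexists; split; [exact: h1|exact: h2].
Qed.

Lemma iter_inY k d : (1 <= d <= it_dhat (its k))%N -> inY d (it_y (its k) d).
Proof. by move=> /iter_stage[v [b [[[[]]]]]]. Qed.

Definition cuts_bounded d := exists K, forall k l n i, (i < size (Lk R P L0 its k d l n))%N ->
  forall y w, inY d y ->
  `|cutval R P (nth (lcut0 R P d) (Lk R P L0 its k d l n) i) x (y w) (bd d.+1 l n)| <= K.

(** These three quantities control a new cut at the current [x], where its term in [lc_lam]
    vanishes. *)
Definition newcuts_bounded d := exists2 B, 0 <= B &
  forall k n, (d < it_dhat (its k))%N -> let c := it_lc (its k) d n in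
  [/\ `|lc_th c| <= B, norm1 (lc_sig c) <= B & normb (lc_nu c) <= B].

(** A move by [r] along a coordinate axis, in either direction, stays in the domain, where the
    optimal value is at most [B]. As it starts from at least [- B], each coordinate of the slopes is
    bounded by [2 * B / r]. *)
Lemma newcuts_boundedP d : (1 <= d)%N -> (d < dd)%N ->
  ((d.+1 < dd)%N -> cuts_bounded d.+1) -> newcuts_bounded d.
Proof.
move=> d1 dlt cb.
have d2 : (2 <= d.+1 <= dd)%N by rewrite ltnS d1.
have [r r0 interior] := Dom_interior d d2.
have [|KY KY0 YK] := Y_bound d.+1; first by rewrite dlt.
have [K K0 cutK] : exists2 K, 0 <= K & (d.+1 < dd)%N -> forall k l n i,
   (i < size (Lk R P L0 its k d.+1 l n))%N -> forall y w, inY d.+1 y ->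
  `|cutval R P (nth (lcut0 R P d.+1) (Lk R P L0 its k d.+1 l n) i) x (y w) (bd d.+2 l n)| <= K.
  case: (ltnP d.+1 dd) cb => [_ /(_ isT)[K hK]|_ _]; last by exists 0.
  exists `|K| => // _ k l n i si y w Yy.
  by apply: le_trans (hK k l n i si y w Yy) (ler_norm K).
pose A := norm1 (cost d.+1) * KY.
have costA y w : inY d.+1 y -> `|dotv (cost d.+1) (y w)| <= A.
  move=> Yy; apply: le_trans (norm_dotv _ _ _ _) _.
  by apply: ler_wpM2l; [apply: norm1_ge0|apply: YK].
have A0 : 0 <= A by rewrite mulr_ge0 ?norm1_ge0.
(* The optimal value is bounded above on the whole domain, uniformly in the
   iteration, and below at the optimal solutions. *)
have LPub k n v b : (exists y, stagecon d.+1 x v b y) ->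
    (LPval d.+1 n (Lk R P L0 its k d.+1 n) x v b <= (A + K)%:E)%E.
  (* Any admissible [y] is completed by the constant [K], which dominates all cuts. *)
  move=> [y yc]; apply: le_trans (LPval_le (y := y) (th := fun _ _ => K) _) _.
    split=> // dl w n' i si; apply: le_trans (ler_norm _) _.
    by apply: cutK => //; case: yc.
  rewrite lee_fin; apply: stobj_le => // w.
  by apply: le_trans (ler_norm _) (costA _ _ _); case: yc.
have LPlb k n v b y th : LPopt d.+1 n (Lk R P L0 its k d.+1 n) x v b y th ->
    - (A + K) <= stobj d.+1 n y th.
  move=> opt; have [[[Yy yc] cuts] _] := opt; apply: stobj_ge => // [w|dl w n' pn].
    by have := costA y w Yy; rewrite ler_norml => /andP[].
  (* Existence of an optimum provides a stored cut, and this cut keeps [th] above [- K]. *)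
  have s0 := LPopt_nonempty _ _ _ _ _ _ _ _ opt dl pn.
  apply: le_trans (cuts dl w n' 0%N s0).
  by have := cutK dl k n n' 0%N s0 y w Yy; rewrite ler_norml => /andP[].
pose B := A + K.
(* Numbers of coordinates, which turn coordinatewise bounds into bounds on the 1-norms. *)
pose N := (nd d)%:R : R; pose M := (#|Sc|)%:R * ((qd d.+1)%:R) : R.
have B0 : 0 <= B by rewrite addr_ge0.
have Br0 : 0 <= 2 * B / r by rewrite divr_ge0 ?mulr_ge0// ltW.
have N0 : 0 <= N := ler0n _ _.
have M0 : 0 <= M by rewrite mulr_ge0.
have NB : 0 <= N * (2 * B / r) by rewrite mulr_ge0.
have MB : 0 <= M * (2 * B / r) by rewrite mulr_ge0.
exists (B + (N + M) * (2 * B / r)).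
  by rewrite addr_ge0// mulr_ge0// addr_ge0.
move=> k n dh c.
have [_ [_ [_ [_ [_ [_ [bwd _]]]]]]] := allOK k.
have [_ [_ [_ [[y' [th' opt]] [cth [_ [csig [cnu _]]]]]]]] :=
  bwd d (introT andP (conj d1 dh)) n.
have Yv : Ycomp d (it_w (its k) d) (it_y (its k) d (it_w (its k) d)).
  by exists (it_y (its k) d); split=> //; apply: iter_inY; rewrite d1 ltnW.
(* The backward pass works with the enlarged collections. These are the collections after [k.+1]
   iterations, so the bounds above apply. *)
have LE : updL R P (Lk R P L0 its k) (its k) = Lk R P L0 its k.+1 by [].
rewrite LE in opt cth csig cnu.
move: Yv opt cth csig cnu; rewrite -/c.
set v := it_y (its k) d _; set b := bd _ _ _ => Yv opt cth csig cnu.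
have thlb : - B <= lc_th c.
  by have := LPlb _ _ _ _ _ _ opt; rewrite -lee_fin -(LPval_opt opt) -cth lee_fin.
have interior' := interior (it_m (its k) d) n _ _ Yv.
have sbb : normb (subb b b) = 0.
  by rewrite [normb _]big1// => u _; rewrite /Defs.subb subrr norm10.
have sub0 : norm1 (v - v) = 0 by rewrite subrr norm10.
have thub : lc_th c <= B.
  by rewrite -lee_fin cth; apply: LPub; apply: interior'; rewrite ?sbb ?sub0 ltW.
have sigb i : `|lc_sig c i 0| <= 2 * B / r.
  have dir s : `|s| = 1 -> s * lc_sig c i 0 <= 2 * B / r.
    move=> s1; pose v' := v + (s * r) *: delta_mx i 0.
    have v'v : v' - v = (s * r) *: delta_mx i 0 by rewrite /v' addrC addKr.
    have /LPub h : exists y, stagecon d.+1 x v' b y.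
      apply: interior'; last by rewrite sbb ltW.
      by rewrite v'v norm1Z norm1_delta mulr1 normrM s1 mul1r gtr0_norm.
    have := le_trans (csig v') (h _ _); rewrite lee_fin v'v dotvZr dotv_delta -/B => h'.
    rewrite ler_pdivlMr//; lra.
  rewrite ler_norml; apply/andP; split.
    by have := dir (-1); rewrite normrN1 mulN1r lerNl => /(_ erefl).
  by have := dir 1; rewrite normr1 mul1r => /(_ erefl).
have nub u i : `|lc_nu c u i 0| <= 2 * B / r.
  have dir s : `|s| = 1 -> s * lc_nu c u i 0 <= 2 * B / r.
    move=> s1; pose b' u' := b u' + (s * r * (u' == u)%:R) *: delta_mx i 0 : 'cV[R]_(qd d.+1).
    have b'b : subb b' b = fun u' => (s * r * (u' == u)%:R) *: delta_mx i 0.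
      by apply: funext => u'; rewrite /Defs.subb /b' addrC addKr.
    have nb : normb (subb b' b) = r.
      rewrite b'b [normb _](bigD1 u)//= eqxx norm1Z norm1_delta !mulr1 normrM s1 mul1r.
      rewrite gtr0_norm// big1 ?addr0// => u' /negPf ->.
      by rewrite mulr0 scale0r norm10.
    have /LPub h : exists y, stagecon d.+1 x v b' y.
      by apply: interior'; rewrite ?sub0 ?nb// ltW.
    have := le_trans (cnu b') (h _ _); rewrite lee_fin b'b [dotb _ _](bigD1 u)//=.
    rewrite eqxx big1 => [|u' /negPf ->]; last by rewrite mulr0 scale0r dotv0r.
    rewrite addr0 dotvZr dotv_delta mulr1 -/B => h'.
    rewrite ler_pdivlMr//; lra.
  rewrite ler_norml; apply/andP; split.
    by have := dir (-1); rewrite normrN1 mulN1r lerNl => /(_ erefl).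
  by have := dir 1; rewrite normr1 mul1r => /(_ erefl).
split.
- rewrite ler_norml; apply/andP; split; lra.
- apply: le_trans (norm1_le _ _ _ _ sigb) _; rewrite -/N; lra.
- have : normb (lc_nu c) <= M * (2 * B / r); last by lra.
  rewrite /M -mulrA mulr_natl -sumr_const.
  by apply: ler_sum => u _; apply: norm1_le.
Qed.

(** The initial cuts are finitely many, each bounded on the bounded set [Y_d]; later ones have
    bounded slopes and are placed at components of points of [Y_d] and at data from a finite set. *)
Lemma cuts_boundedP d : (1 <= d)%N -> (d < dd)%N -> newcuts_bounded d -> cuts_bounded d.
Proof.
move=> d1 dlt [B B0 newB].
have [|KY KY0 YK] := Y_bound d; first by rewrite d1 ltnW.
have cutle (c : lcut R P d) y w b : inY d y -> `|cutval R P c x (y w) b| <=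
    `|lc_th c| + norm1 (lc_lam c) * norm1 (x - lc_x c) +
    norm1 (lc_sig c) * (KY + norm1 (lc_y c)) +
    normb (lc_nu c) * normb (subb b (lc_b c)).
  move=> Yy; rewrite /cutval.
  apply: (le_trans (ler_normD _ _)); apply: lerD; last exact: norm_dotb.
  apply: (le_trans (ler_normD _ _)); apply: lerD.
    by apply: (le_trans (ler_normD _ _)); apply: lerD => //; apply: norm_dotv.
  apply: le_trans (norm_dotv _ _ _ _) _; apply: ler_wpM2l; first exact: norm1_ge0.
  by apply: le_trans (norm1B _ _ _ _) _; rewrite lerD2r YK.
have [K1 K10 hK1] : exists2 K, 0 <= K & forall (u : St * St) i,
    (i < size (L0 d u.1 u.2))%N ->
    forall y w, inY d y ->
    `|cutval R P (nth (lcut0 R P d) (L0 d u.1 u.2) i) x (y w) (bd d.+1 u.1 u.2)| <= K.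
  apply: (fin_uniform_ub R (St * St)%type (fun u K => forall i, (i < size (L0 d u.1 u.2))%N ->
    forall y w, inY d y ->
    `|cutval R P (nth (lcut0 R P d) (L0 d u.1 u.2) i) x (y w) (bd d.+1 u.1 u.2)| <= K)).
    by move=> u s t st h i si y w Yy; apply: le_trans (h i si y w Yy) st.
  move=> [l n] /=; elim: (L0 d l n) => [|c s [K IH]]; first by exists 0.
  eexists (Num.max K _) => -[_|i si] y w Yy /=.
    by rewrite le_max; apply/orP; right; apply: (cutle c).
  by rewrite le_max (IH i si y w Yy).
(* A cut for next state [n] is placed at the data of one current state but shared by all of them;
   [K2] bounds the distance between two such data. *)
have [K2 K20 hK2] : exists2 K, 0 <= K & forall u : (St * St * St),
    normb (subb (bd d.+1 u.1.1 u.1.2) (bd d.+1 u.2 u.1.2)) <= K.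
  apply: (fin_uniform_ub R (St * St * St)%type (fun u K =>
    normb (subb (bd d.+1 u.1.1 u.1.2) (bd d.+1 u.2 u.1.2)) <= K)).
    by move=> u s t st h; apply: le_trans h st.
  by move=> u; eexists.
exists (K1 + (B + B * (KY + KY) + B * K2)).
have nn : 0 <= B + B * (KY + KY) + B * K2 by rewrite !addr_ge0 ?mulr_ge0 ?addr_ge0.
elim=> [|k IH] l n i /=.
  by move=> si y w Yy; apply: le_trans (hK1 (l, n) i si y w Yy) _; rewrite lerDl.
rewrite /updL; case: ifP => [|_]; last by rewrite cats0; apply: IH.
move=> /andP[_ dh]; rewrite size_cat nth_cat /= => si y w Yy; case: ifP => [si'|].
  exact: IH.
move=> /negbT; rewrite -leqNgt => si'.
have -> : (i - size (Lk R P L0 its k d l n))%N = 0%N.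
  by apply/eqP; move: si; rewrite addn1 ltnS subn_eq0.
have [_ [_ [_ [_ [_ [_ [bwd _]]]]]]] := allOK k.
have [cx [cy [cb _]]] := bwd d (introT andP (conj d1 dh)) n.
have [h1 h2 h3] := newB k n dh; rewrite /=.
apply: le_trans (cutle _ _ _ _ Yy) _; rewrite cx cy cb subrr norm10 mulr0 addr0.
apply: le_trans (_ : B + B * (KY + KY) + B * K2 <= _); last by rewrite lerDr.
apply: lerD; first apply: lerD => //.
  apply: ler_pM => //; first exact: norm1_ge0.
    by rewrite addr_ge0 ?norm1_ge0.
  by rewrite lerD2l YK//; apply: iter_inY; rewrite d1 ltnW.
apply: ler_pM => //; [exact: normb_ge0|exact: normb_ge0|].
exact: (hK2 (l, n, it_m (its k) d)).
Qed.

(** Backward induction, with [j] bounding the number of remaining stages: the slopes at stage [d]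
    are controlled by the cuts of stage [d.+1]. *)
Lemma all_newcuts_bounded d : (1 <= d)%N -> (d < dd)%N -> newcuts_bounded d.
Proof.
move: {2}(dd - d)%N (leqnn (dd - d)) => j; elim: j d => [|j IH] d.
  by rewrite leqn0 subn_eq0 leqNgt => /negPf ->.
move=> dj d1 dlt; apply: newcuts_boundedP => // dlt'.
apply: cuts_boundedP => //; apply: IH => //.
by rewrite subnS -ltnS prednK ?subn_gt0.
Qed.

(** * Convergence *)

Hypothesis delta0 : 0 < delta.
Hypothesis never : forall k, ~ stopped R P x delta L0 U0 its k.

Local Notation eps := (delta / (dd - 1)%:R).
Local Notation thr := (thr R P delta).

Lemma dd1_gt0 : 0 < (dd - 1)%:R :> R.
Proof. by have [d2 _] := stx; rewrite ltr0n subn_gt0. Qed.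

Lemma thrS d : (d < dd)%N -> thr d.+1 = thr d - eps.
Proof.
move=> dlt; rewrite /Defs.thr; have -> : (dd - d + 1 = (dd - d.+1 + 1).+1)%N.
  by rewrite -addSn -subSn// subSS.
by rewrite -[(_ + 1).+1%:R]natr1; field; rewrite gt_eqF ?dd1_gt0.
Qed.

Lemma it_lc_stored k k' d l n : (k < k')%N -> (1 <= d < it_dhat (its k))%N ->
  exists2 i, (i < size (Lk R P L0 its k' d l n))%N &
    nth (lcut0 R P d) (Lk R P L0 its k' d l n) i = it_lc (its k) d n.
Proof.
elim: k' => // k' IH; rewrite ltnS leq_eqVlt => /predU1P[<-|kk'] dh /=.
  exists (size (Lk R P L0 its k d l n)); rewrite /updL dh ?size_cat ?addn1//.
  by rewrite nth_cat ltnn subnn.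
have [i si ni] := IH kk' dh; exists i; rewrite /updL ?size_cat ?nth_cat ?si//.
by apply: leq_trans si (leq_addr _ _).
Qed.

Lemma it_uc_stored k k' d l n : (k < k')%N -> (1 <= d < it_dhat (its k))%N ->
  exists2 i, (i < size (Uk R P U0 its k' d l n))%N &
    nth (ucut0 R P d) (Uk R P U0 its k' d l n) i = it_uc (its k) d n.
Proof.
elim: k' => // k' IH; rewrite ltnS leq_eqVlt => /predU1P[<-|kk'] dh /=.
  exists (size (Uk R P U0 its k d l n)); rewrite /updU dh ?size_cat ?addn1//.
  by rewrite nth_cat ltnn subnn.
have [i si ni] := IH kk' dh; exists i; rewrite /updU ?size_cat ?nth_cat ?si//.
by apply: leq_trans si (leq_addr _ _).
Qed.

(** The backward pass starts at stage [e.+1] with the collections of the forward pass. The forward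
    decision and its upper completion are feasible for the upper problem, so the gap is at most an
    average of next-stage gaps, which the next threshold bounds. *)
Lemma newcut_gap k e : (1 <= e)%N -> it_dhat (its k) = e.+1 ->
  uc_th (it_uc (its k) e (it_m (its k) e.+1)) - lc_th (it_lc (its k) e (it_m (its k) e.+1))
    <= thr e.+1 - eps.
Proof.
move=> e1 dhE; have [_ [_ [_ [dh1 [stg [stop [bwd _]]]]]]] := allOK k.
rewrite dhE in dh1 stg stop bwd; set n := it_m (its k) e.+1.
have [|_ [_ [_ [opt up]]]] := stg e.+1; first by rewrite ltnS e1 /=.
have [|_ [_ [_ [_ [cth [_ [_ [_ [_ [_ [_ uth]]]]]]]]]]] := bwd e _ n; first by rewrite e1 /=.
(* The iteration adds cuts at stages up to [e] only. *)
have LE : updL R P (Lk R P L0 its k) (its k) e.+1 n = Lk R P L0 its k e.+1 n.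
  by apply: funext => n'; rewrite /updL dhE ltnn andbF cats0.
have UE : updU R P (Uk R P U0 its k) (its k) e.+1 n = Uk R P U0 its k e.+1 n.
  by apply: funext => n'; rewrite /updU dhE ltnn andbF cats0.
rewrite LE (LPval_opt opt) in cth; rewrite UE in uth.
have {}cth : lc_th (it_lc (its k) e n) = stobj e.+1 n (it_y (its k) e.+1) (it_lv (its k) e.+2).
  by case: cth.
have [elt|ege] := ltnP e.+1 dd.
  have [gam [zet [mu [feas _]]]] := up elt.
  have := UPval_le feas; rewrite -/n -uth lee_fin cth => h.
  apply: le_trans (lerB h (lexx _)) _; rewrite -thrS//.
  by apply: stobj_gap_le => // w n'; apply: stop.
(* At the last stage both problems coincide, so the gap is at most zero, and the threshold is
   exactly [eps]. *)
have feas : UPfeas e.+1 n (Uk R P U0 its k e.+1 n) x (it_y (its k) e (it_w (its k) e))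
    (bd e.+1 (it_m (its k) e) n) (it_y (its k) e.+1) (it_lv (its k) e.+2)
    (fun _ _ => 0) (fun _ _ _ => 0) (fun _ _ _ => 0).
  by split; [case: opt => -[]|rewrite /Defs.notlast ltnNge ege].
have := UPval_le feas; rewrite -uth lee_fin cth => h.
have thrE : thr e.+1 = eps.
  have -> : e.+1 = dd by apply/eqP; rewrite eqn_leq ege andbT; case/andP: dh1.
  by rewrite /Defs.thr subnn add0n mulr1.
by rewrite thrE subrr subr_le0.
Qed.

(** At the point of iteration [k'], the earlier lower cut bounds [it_lv] from below with slope
    [lc_sig], and the earlier upper point bounds [it_uv] from above with slope [My]. *)
Lemma later_gap k k' e : (k < k')%N -> (1 <= e)%N ->
  it_dhat (its k) = e.+1 -> it_dhat (its k') = e.+1 ->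
  it_m (its k) e = it_m (its k') e -> it_m (its k) e.+1 = it_m (its k') e.+1 ->
  it_w (its k) e = it_w (its k') e ->
  let w := it_w (its k') e in let n := it_m (its k') e.+1 in
  it_uv (its k') e.+1 w n - it_lv (its k') e.+1 w n <= thr e.+1 - eps +
    (My + norm1 (lc_sig (it_lc (its k) e n))) * norm1 (it_y (its k') e w - it_y (its k) e w).
Proof.
move=> kk' e1 dh dh' me mS we /=.
set w := it_w (its k') e; set n := it_m (its k') e.+1.
have := newcut_gap k e e1 dh; rewrite mS -/n => gap.
have [_ [_ [_ [_ [_ [_ [bwd _]]]]]]] := allOK k.
have [|cx [cy [cb [_ [_ [_ [_ [_ [uy [ub _]]]]]]]]]] := bwd e _ n; first by rewrite e1 dh /=.
have [_ [_ [_ [dh1 [stg _]]]]] := allOK k'.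
have elt : (e < dd)%N by rewrite dh' in dh1; case/andP: dh1.
have [|pn _] := stg e.+1; first by rewrite dh' ltnS e1 /=.
rewrite -/n /= in pn.
have [|v [b [[[_ cuts] _] up]]] := iter_stage k' e; first by rewrite e1 dh' leqnSn.
have [gam [zet [mu opt]]] := up elt.
have inn : (1 <= e < it_dhat (its k))%N by rewrite e1 dh /=.
have [i si ni] := it_lc_stored k k' e (it_m (its k') e) n kk' inn.
have [j sj nj] := it_uc_stored k k' e (it_m (its k') e) n kk' inn.
have := cuts elt w n i si; rewrite ni /cutval cx cy cb we -/w me.
(* The terms in [x] and in the data vanish: [x] is fixed, and both iterations have the same states
   at stages [e] and [e.+1]. *)
rewrite subrr dotv0r addr0 dotbBr subrr addr0 => low.
have := UPoptFix_le _ _ _ _ _ _ _ _ _ _ w n j opt elt pn sj.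
rewrite nj ub uy we -/w me => /(_ erefl) upp.
rewrite -norm1N opprB in upp.
have := norm_dotv _ _ (lc_sig (it_lc (its k) e n)) (it_y (its k') e w - it_y (its k) e w).
by rewrite ler_norml => /andP[sg _]; lra.
Qed.

(** Stopping the forward pass at stage 1 would give the chosen state a gap of at most [thr 2], which
    is [delta]. This state has the largest gap among those of positive probability, so the criterion
    would have held one iteration earlier. The first iteration is left out because its previous gaps
    are infinite. *)
Lemma dhat_ge2 k : (2 <= it_dhat (its k.+1))%N.
Proof.
have [d2 [_ [pi0 [pi1 _]]]] := stx.
rewrite ltnNge; apply/negP => dh1.
have [[p1 mmax] [opt1 [[gam [zet [mu [feas _]]]] [dh [_ [stop _]]]]]] := allOK k.+1.
have dhE : it_dhat (its k.+1) = 1%N by apply/eqP; rewrite eqn_leq dh1; case/andP: dh.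
rewrite dhE in stop.
have [_ [_ [_ [_ [_ [_ [_ last]]]]]]] := allOK k.
have finite m : exists s t, uth1 R P x (Uk R P U0 its k.+1) m = s%:E /\
    th1 R P x (Lk R P L0 its k.+1) m = t%:E.
  have [[y [t opt]] [y' [s [gam' [zet' [mu' opt']]]]]] := last m.
  by do 2 eexists; split; [exact: (UPval_opt opt')|exact: (LPval_opt opt)].
have /choice[s /choice[t st]] := finite.
have gap : s (it_m (its k.+1) 1%N) - t (it_m (its k.+1) 1%N) <= delta.
  have [us lt] := st (it_m (its k.+1) 1%N).
  have := UPval_le feas; have := LPval_opt opt1.
  rewrite -/(th1 R P x (Lk R P L0 its k.+1) (it_m (its k.+1) 1%N)).
  rewrite -/(uth1 R P x (Uk R P U0 its k.+1) (it_m (its k.+1) 1%N)) us lt lee_fin => -[->] h.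
  apply: le_trans (lerB h (lexx _)) _.
  apply: stobj_gap_le => // w n pn; apply: le_trans (stop d2 w n pn) _.
  by rewrite /Defs.thr addn1 -subSn// subSS mulfK// gt_eqF ?dd1_gt0.
apply: (never k); rewrite /stopped /uppb /lowb.
have -> : (\sum_m (pi1_ R P m)%:E * uth1 R P x (Uk R P U0 its k.+1) m =
           (\sum_m pi1_ R P m * s m)%:E)%E.
  by rewrite -sumEFin; apply: eq_bigr => m _; case: (st m) => -> _.
have -> : (\sum_m (pi1_ R P m)%:E * th1 R P x (Lk R P L0 its k.+1) m =
           (\sum_m pi1_ R P m * t m)%:E)%E.
  by rewrite -sumEFin; apply: eq_bigr => m _; case: (st m) => _ ->.
rewrite -EFinB lee_fin -sumrB -[leRHS]mul1r -pi1 mulr_suml; apply: ler_sum => m _.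
rewrite -mulrBr; have := pi0 m; rewrite le_eqVlt => /predU1P[<-|pm]; first by rewrite !mul0r.
rewrite ler_pM2l//; apply: le_trans gap; have := mmax m pm; rewrite /prevgap.
have [-> ->] := st m; have [-> ->] := st (it_m (its k.+1) 1%N).
by rewrite -!EFinB lee_fin.
Qed.

Lemma never_stopped_absurd : False.
Proof.
have [d2 _] := stx.
have eps0 : 0 < eps by rewrite divr_gt0 ?dd1_gt0.
have My0 : 0 < My by have [_ [_ [_ [_ [_ [_ [_ [_ [_ [h _]]]]]]]]]] := stx.
have [B B0 sigB] : exists2 B, 0 <= B & forall e : 'I_dd, (1 <= e)%N -> forall k n,
    (e < it_dhat (its k))%N -> norm1 (lc_sig (it_lc (its k) e n)) <= B.
  apply: (fin_uniform_ub R _ (fun (e : 'I_dd) B => (1 <= e)%N -> forall k n,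
    (e < it_dhat (its k))%N -> norm1 (lc_sig (it_lc (its k) e n)) <= B)).
    by move=> e s t st h e1 k n ek; apply: le_trans (h e1 k n ek) st.
  move=> e; have [e1|] := ltnP 0 e; last by exists 0.
  have [B _ hB] := all_newcuts_bounded e e1 (ltn_ord e).
  by exists B => _ k n ek; have [] := hB k n ek.
have [K K0 YK] : exists2 K, 0 <= K & forall e : 'I_dd, (1 <= e)%N -> forall y w,
    inY e y -> norm1 (y w) <= K.
  apply: (fin_uniform_ub R _ (fun (e : 'I_dd) K => (1 <= e)%N -> forall y w,
    inY e y -> norm1 (y w) <= K)).
    by move=> e s t st h e1 y w Yy; apply: le_trans (h e1 y w Yy) st.
  move=> e; have [e1|] := ltnP 0 e; last by exists 0.
  have [|K _ hK] := Y_bound e; first by rewrite e1 ltnW.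
  by exists K.
pose N := \max_(e < dd) nd e.
(* The count starts with the second iteration, where [dhat_ge2] applies; [e k] is the stage that
   receives the relevant cuts. *)
pose D k := it_dhat (its k.+1); pose e k := (D k).-1.
have DE k : D k = (e k).+1 by rewrite prednK// (ltn_trans _ (dhat_ge2 k)).
have e1 k : (1 <= e k)%N by rewrite -ltnS -DE dhat_ge2.
have edd k : (e k < dd)%N.
  by have [_ [_ [_ [/andP[_ h] _]]]] := allOK k.+1; rewrite -DE.
pose yp k f := it_y (its k.+1) f (it_w (its k.+1) f).
(* Points of different stages are padded with zeros to the common length [N], to compare them in one
   space. *)
pose u k f (i : 'I_N) : R := if insub (i : nat) is Some j then yp k f j 0 else 0.
have uK k i : `|u k (e k) i| <= K.
  rewrite /u; case: insubP => [j _ _|_]; last by rewrite normr0.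
  apply: le_trans (norm1_coord _ _ _ _) _; apply: (YK (Ordinal (edd k)) (e1 k)).
  by apply: iter_inY; rewrite e1 -/(D k) DE leqnSn.
pose col k := (inord (D k) : 'I_dd.+1, it_m (its k.+1) (e k), it_m (its k.+1) (e k).+1,
  it_w (its k.+1) (e k)).
(* Coordinates within [eps / M] give a distance of at most [N * (eps / M)], and the slope factor
   [My + B] times this is below [eps]; the summand 1 makes this strict. *)
pose M := (My + B) * N%:R + 1.
have M0 : 0 < M by rewrite ltr_wpDl// mulr_ge0// addr_ge0// ltW.
have [i [j [ij colE close]]] := bounded_close_pair R _ col N
  (fun k => u k (e k)) K (eps / M) (divr_gt0 eps0 M0) uK.
have eij : e i = e j.
  case: colE => /(congr1 val) /= + _ _ _; rewrite !inordK ?DE ?ltnS ?edd//.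
  by case.
case: colE => _ me mS we.
rewrite eij in me mS we close.
have dhi : it_dhat (its i.+1) = (e j).+1 by rewrite -[LHS]/(D i) DE eij.
have dhj : it_dhat (its j.+1) = (e j).+1 by rewrite -[LHS]/(D j) DE.
have eN : (nd (e j) <= N)%N := leq_bigmax_cond (F := fun e : 'I_dd => nd e) (Ordinal (edd j)) isT.
have dist : norm1 (yp j (e j) - yp i (e j)) <= N%:R * (eps / M).
  apply: le_trans (norm1_le _ _ _ (eps / M) _) _ => [l|].
    have := close (widen_ord eN l); rewrite /u /= (valK l) distrC => /ltW.
    by rewrite !mxE.
  by apply: ler_wpM2r; [apply: ltW; apply: divr_gt0|rewrite ler_nat].
have gap := later_gap i.+1 j.+1 (e j) ij (e1 j) dhi dhj me mS we.
(* The later forward pass went on to this stage only because the gap there exceeded the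
   threshold. *)
have [_ [_ [_ [_ [stg _]]]]] := allOK j.+1.
have [|_ [_ [big _]]] := stg (e j).+1; first by rewrite dhj ltnS e1 /=.
have := sigB (Ordinal (edd j)) (e1 j) i.+1 (it_m (its j.+1) (e j).+1).
rewrite dhi ltnSn => /(_ isT) /= sB.
move: gap big dist; rewrite /= /yp we.
set g := it_uv _ _ _ _ - _; set n := norm1 (_ - _); set sg := norm1 _ => gap big dist.
have n0 : 0 <= n := norm1_ge0 _ _ _.
have : (My + sg) * n <= (My + B) * (N%:R * (eps / M)).
  by apply: ler_pM => //; [rewrite addr_ge0 ?norm1_ge0// ltW|rewrite lerD2l].
have : M * (eps / M) = eps by rewrite mulrC divfK ?gt_eqF.
have : 0 < eps / M by apply: divr_gt0.
rewrite {1 2}/M; set q := eps / M; lra.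
Qed.

End Run.
End Standing.
End Instance.

(* For every instance satisfying the standing assumptions (at the fixed first-
   stage decision x), every tolerance delta > 0, every initial finite cut
   collections L0, U0 and every run its of Algorithm 2, the stopping criterion
   overline theta^k - underline theta^k <= delta is met after finitely many
   iterations. *)
Theorem theorem2 (R : realType) (P : MSP R) (x : 'cV[R]_(px_ R P)) (delta : R)
    (L0 : lcolls R P) (U0 : ucolls R P) (its : nat -> itdata R P) :
  standing R P x ->
  0 < delta ->
  run2 R P x delta L0 U0 its ->
  exists k : nat, stopped R P x delta L0 U0 its k.
Proof.
move=> stx delta0 run; apply: contrapT => none.
have never k : ~ stopped R P x delta L0 U0 its k by move=> sk; apply: none; exists k.
by apply: (never_stopped_absurd R P x stx delta L0 U0 its) => // k; apply: run.
Qed.
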